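(* There is an algorithm which, given an irreducible graph $G=(V,E)$ with $n$ vertices, diameter $\mathrm{diam}(G)=3$, minimum degree $\delta$ and maximum degree $\Delta$, decides whether $G$ admits a proper $3$-coloring in time $2^{O(\min\{\delta\Delta,\ \frac{n}{\delta}\log\delta\})}$.
   Context: Graphs are finite, simple and undirected. For a vertex $u$, $N(u)$ is its set of neighbors. A proper $3$-coloring assigns one of three colors to each vertex so that adjacent vertices receive different colors. The diamond is the graph on $4$ vertices with $5$ edges ($K_4$ minus one edge). A graph $G$ is called irreducible if it contains no $K_4$ as an induced subgraph, contains no induced diamond, and has no two distinct vertices $u,v$ with $N(u)\subseteq N(v)$. *)

(* Defs.v *)
From HB Require Import structures.
From mathcomp Require Import all_boot all_order all_algebra.
From mathcomp Require Import reals exp.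

Set Implicit Arguments.
Unset Strict Implicit.
Unset Printing Implicit Defensive.

Record sgraph (V : finType) := SGraph {
  adj :> rel V;
  adj_sym : symmetric adj;
  adj_irrefl : irreflexive adj }.

Definition neighbors (V : finType) (G : sgraph V) (u : V) : {set V} :=
  [set v | G u v].

Definition degree (V : finType) (G : sgraph V) (u : V) : nat :=
  #|neighbors G u|.

(* #|V| is a neutral element here, since every degree is smaller than #|V|. *)
Definition min_degree (V : finType) (G : sgraph V) : nat :=
  \big[minn/#|V|]_(u : V) degree G u.

Definition max_degree (V : finType) (G : sgraph V) : nat :=
  \max_(u : V) degree G u.

Definition is_distance (V : finType) (G : sgraph V) (u v : V) (d : nat) : Prop :=
  (exists p : seq V, [/\ path G u p, last u p = v & size p = d]) /\
  (forall p : seq V, path G u p -> last u p = v -> d <= size p).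

(* A disconnected graph (infinite diameter) satisfies this for no d. *)
Definition is_diameter (V : finType) (G : sgraph V) (d : nat) : Prop :=
  (forall u v : V, exists2 k, is_distance G u v k & k <= d) /\
  (exists u v : V, is_distance G u v d).

Definition contains_induced (U V : finType) (H : sgraph U) (G : sgraph V) : Prop :=
  exists f : U -> V, injective f /\ forall x y, G (f x) (f y) = H x y.

Definition K4_adj : rel 'I_4 := fun x y => x != y.

Lemma K4_sym : symmetric K4_adj.
Proof. by move=> x y; rewrite /K4_adj eq_sym. Qed.

Lemma K4_irrefl : irreflexive K4_adj.
Proof. by move=> x; rewrite /K4_adj eqxx. Qed.

Definition K4 : sgraph 'I_4 := SGraph K4_sym K4_irrefl.

(* The edge removed from K4 is {0, 1}. *)
Definition diamond_adj : rel 'I_4 :=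
  fun x y => (x != y) && ~~ ((x < 2) && (y < 2)).

Lemma diamond_sym : symmetric diamond_adj.
Proof. by move=> x y; rewrite /diamond_adj eq_sym andbC [in RHS]andbC [(y < 2) && _]andbC. Qed.

Lemma diamond_irrefl : irreflexive diamond_adj.
Proof. by move=> x; rewrite /diamond_adj eqxx. Qed.

Definition diamond : sgraph 'I_4 := SGraph diamond_sym diamond_irrefl.

Definition irreducible_graph (V : finType) (G : sgraph V) : Prop :=
  [/\ ~ contains_induced K4 G,
      ~ contains_induced diamond G &
      forall u v : V, u != v -> ~~ (neighbors G u \subset neighbors G v)].

Definition colorable (k : nat) (V : finType) (G : sgraph V) : Prop :=
  exists c : V -> 'I_k, forall u v, G u v -> c u != c v.

(* Model of computation: structured programs for a random access machine with
   registers and one memory, both indexed by and containing natural numbers.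
   Every elementary operation takes one unit of time.  Addition and truncated
   subtraction are the only arithmetic primitives: with unit-cost
   multiplication, polynomial time on such a machine would no longer agree with
   polynomial time on Turing machines. *)
Inductive expr :=
| EConst of nat
| EReg of nat
| EMem of expr
| EAdd of expr & expr
| ESub of expr & expr.

Inductive program :=
| Skip
| SetReg of nat & expr
| SetMem of expr & expr
| Seq of program & program
| If of expr & program & program
| While of expr & program.

Record state := State { regs : nat -> nat; cells : nat -> nat }.

Definition update (f : nat -> nat) (i v : nat) : nat -> nat :=
  fun j => if j == i then v else f j.

Fixpoint eval (s : state) (e : expr) : nat :=
  match e with
  | EConst c => c
  | EReg i => regs s i
  | EMem e1 => cells s (eval s e1)
  | EAdd e1 e2 => eval s e1 + eval s e2
  | ESub e1 e2 => eval s e1 - eval s e2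
  end.

Fixpoint eval_time (e : expr) : nat :=
  match e with
  | EConst _ | EReg _ => 1
  | EMem e1 => (eval_time e1).+1
  | EAdd e1 e2 | ESub e1 e2 => (eval_time e1 + eval_time e2).+1
  end.

(* exec P s t s' : started in s, P halts in s' after exactly t time units. *)
Inductive exec : program -> state -> nat -> state -> Prop :=
| ExecSkip s :
    exec Skip s 1 s
| ExecSetReg i e s :
    exec (SetReg i e) s (eval_time e).+1
      (State (update (regs s) i (eval s e)) (cells s))
| ExecSetMem a e s :
    exec (SetMem a e) s (eval_time a + eval_time e).+1
      (State (regs s) (update (cells s) (eval s a) (eval s e)))
| ExecSeq P Q s t s' t' s'' :
    exec P s t s' -> exec Q s' t' s'' ->
    exec (Seq P Q) s (t + t') s''
| ExecIfTrue e P Q s t s' :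
    eval s e != 0 -> exec P s t s' ->
    exec (If e P Q) s ((eval_time e).+1 + t) s'
| ExecIfFalse e P Q s t s' :
    eval s e = 0 -> exec Q s t s' ->
    exec (If e P Q) s ((eval_time e).+1 + t) s'
| ExecWhileTrue e P s t s' t' s'' :
    eval s e != 0 -> exec P s t s' -> exec (While e P) s' t' s'' ->
    exec (While e P) s ((eval_time e).+1 + t + t') s''
| ExecWhileFalse e P s :
    eval s e = 0 ->
    exec (While e P) s (eval_time e).+1 s.

Lemma exec_deterministic P s t1 s1 t2 s2 :
  exec P s t1 s1 -> exec P s t2 s2 -> t1 = t2 /\ s1 = s2.
Proof.
move=> H; elim: H t2 s2 => {P s t1 s1};
  intros; match goal with H : exec _ _ ?t ?s |- _ = ?t /\ _ = ?s => inversion H; subst end;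
  repeat match goal with
  | H : is_true (eval ?s ?e != 0), H' : eval ?s ?e = 0 |- _ => by rewrite H' in H
  | IH : forall t s, exec ?P ?u t s -> _, H : exec ?P ?u _ _ |- _ =>
      case: (IH _ _ H) => ? ?; clear IH; subst
  end; by [].
Qed.

(* A graph on the vertex set {0, ..., n-1} is given by n in register 0 and its
   adjacency matrix, in row-major order, in the first n * n memory cells; all
   other registers and memory cells are initially 0. *)
Definition input (n : nat) (G : sgraph 'I_n) : state :=
  State (fun i => if i == 0 then n else 0)
        (fun a => [exists i : 'I_n, exists j : 'I_n, (a == i * n + j) && G i j]).

Definition accepts (s : state) : Prop := regs s 0 != 0.

Definition log2 (R : realType) (x : R) : R := (ln x / ln 2)%R.

(* Main.v *)
(* A greedily chosen dominating set has at most about (n / delta) log delta vertices,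
   and in a graph of diameter 3 the ball of radius 2 around a vertex of degree delta
   is a dominating set with at most 1 + delta + delta * Delta vertices.  The program
   computes the former and all balls of radius 2, keeps the smallest set D, and tries
   the 3 ^ #|D| colorings of D.  Each of them leaves at most two colors to every other
   vertex, and the resulting 2-SAT instance is solved by eliminating the vertices one
   by one.  A factor polynomial in n is absorbed by the exponent: n is polynomial in
   delta * Delta, log n is O((n / delta) log delta), and irreducibility forces
   delta >= 2, so that log delta >= 1. *)

Require Import Defs.
From HB Require Import structures.
From mathcomp Require Import all_boot all_order all_algebra.
From mathcomp Require Import zify ring lra.
From mathcomp Require Import reals sequences exp.

Set Implicit Arguments.
Unset Strict Implicit.
Unset Printing Implicit Defensive.

(** Both correctness and running time have to be proved for one concrete machine program. Apart from
    the loop over the colorings, it is therefore written in a language whose loops range over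
    vertices or colors only: the meaning of a command is a function on arrays, and the cost of its
    compiled code depends on the syntax and on n + 3 alone, so that polynomiality is an induction on
    commands. The 2-SAT part keeps a table of forbidden pairs of assignments and eliminates a vertex
    by resolution, as in the Davis-Putnam procedure. With at most two colors left at that vertex,
    the resolvent of two pairs is again a pair, so the table never outgrows its (3 n) ^ 2 entries.
    It grows while it is being scanned; monotonicity makes the order of the updates irrelevant. The
    set D is no larger than the greedy set and no larger than any ball, so both terms of the minimum
    bound the same run, and the program never has to compare them. *)

(** * Time-bounded total correctness of machine programs *)

Definition runs (P : program) (s : state) (T : nat) (Q : state -> Prop) : Prop :=
  exists t s', [/\ exec P s t s', t <= T & Q s'].

Definition set_reg (s : state) (r v : nat) : state :=
  State (update (regs s) r v) (cells s).

Lemma runs_weaken P s T T' (Q Q' : state -> Prop) :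
  runs P s T Q -> T <= T' -> (forall s', Q s' -> Q' s') -> runs P s T' Q'.
Proof.
move=> [t [s' [H1 H2 H3]]] H H'; exists t, s'; split=> //; [exact: leq_trans H2 H | exact: H'].
Qed.

Lemma runs_set_reg r e s (Q : state -> Prop) :
  Q (set_reg s r (eval s e)) -> runs (SetReg r e) s (eval_time e).+1 Q.
Proof. by move=> H; exists (eval_time e).+1, (set_reg s r (eval s e)); split=> //; constructor. Qed.

Lemma runs_seq P1 P2 s T1 T2 (Q Q' : state -> Prop) :
  runs P1 s T1 Q' -> (forall s', Q' s' -> runs P2 s' T2 Q) ->
  runs (Seq P1 P2) s (T1 + T2) Q.
Proof.
move=> [t1 [s1 [e1 le1 q1]]] /(_ _ q1) [t2 [s2 [e2 le2 q2]]].
by exists (t1 + t2), s2; split=> //; [apply: ExecSeq e1 e2 | exact: leq_add].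
Qed.

Lemma runs_if e P1 P2 s T1 T2 (Q : state -> Prop) :
  (eval s e != 0 -> runs P1 s T1 Q) -> (eval s e = 0 -> runs P2 s T2 Q) ->
  runs (If e P1 P2) s ((eval_time e).+1 + (T1 + T2)) Q.
Proof.
move=> H1 H2; have [H|H] := eqVneq (eval s e) 0.
- have [t [s' [ex le q]]] := H2 H; exists ((eval_time e).+1 + t), s'; split=> //.
    exact: ExecIfFalse.
  by rewrite leq_add2l (leq_trans le) ?leq_addl.
- have [t [s' [ex le q]]] := H1 H; exists ((eval_time e).+1 + t), s'; split=> //.
    exact: ExecIfTrue.
  by rewrite leq_add2l (leq_trans le) ?leq_addr.
Qed.

Definition count_down (r : nat) (body : program) : program :=
  While (EReg r) (Seq (SetReg r (ESub (EReg r) (EConst 1))) body).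

(** The counter is decremented before the body, which thus sees the indices k - 1 down to 0 and must
    leave the counter intact. A round costs 2 for the test and 4 for the decrement; the final 2 is
    the failing test. *)
Lemma runs_count_down r body T (I : nat -> state -> Prop) :
  (forall k s, I k.+1 s -> regs s r = k.+1 ->
     runs body (set_reg s r k) T (fun s' => I k s' /\ regs s' r = k)) ->
  forall k s, I k s -> regs s r = k ->
  runs (count_down r body) s (k * (T + 6) + 2) (I 0).
Proof.
move=> step; elim=> [|k IHk] s Is rs.
  by exists 2, s; split=> //; apply: (ExecWhileFalse (e := EReg r)).
have [t [s1 [ex le [I1 r1]]]] := step _ _ Is rs.
have [t' [s2 [ex' le' I2]]] := IHk _ I1 r1.
exists (2 + (4 + t) + t'), s2; split=> //; last by lia.
apply: (@ExecWhileTrue (EReg r)) ex'; first by rewrite /= rs.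
apply: ExecSeq ex; have := ExecSetReg r (ESub (EReg r) (EConst 1)) s.
by rewrite /= rs subn1.
Qed.

(** * A source language with bounded loops and arrays *)

(* Every array has four indices, which are loop variables; a scalar or an array
   of smaller dimension leaves the last ones at the variable [z], which no loop
   binds and which is worth 0. *)
Inductive range := Vertices | Colors.

Inductive exp :=
| XC of nat
| XV of nat
| XAdj of nat & nat
| XGet of nat & nat & nat & nat & nat
| XAdd of exp & exp
| XSub of exp & exp
| XIf of exp & exp & exp
| XSum of nat & range & exp.

Inductive cmd :=
| KSkip
| KSet of nat & nat & nat & nat & nat & exp
| KSeq of cmd & cmd
| KIf of exp & cmd & cmd
| KFor of nat & range & cmd.

Definition memory := nat -> nat -> nat -> nat -> nat -> nat.

Definition store (m : memory) (a i j k l v : nat) : memory :=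
  fun a' i' j' k' l' =>
    if [&& a' == a, i' == i, j' == j, k' == k & l' == l] then v
    else m a' i' j' k' l'.

Definition range_size (n : nat) (b : range) : nat := if b is Vertices then n else 3.

(** Indices descend because the compiled loop uses its decreasing counter as the loop variable. *)
Fixpoint floop (T : Type) (k : nat) (f : nat -> T -> T) (m : T) : T :=
  if k is k'.+1 then floop k' f (f k' m) else m.

Section Semantics.
Variables (n : nat) (g : nat -> nat -> nat).

Fixpoint ev (v : nat -> nat) (m : memory) (e : exp) : nat :=
  match e with
  | XC c => c
  | XV x => v x
  | XAdj x y => g (v x) (v y)
  | XGet a x y z w => m a (v x) (v y) (v z) (v w)
  | XAdd e1 e2 => ev v m e1 + ev v m e2
  | XSub e1 e2 => ev v m e1 - ev v m e2
  | XIf e1 e2 e3 => if ev v m e1 != 0 then ev v m e2 else ev v m e3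
  | XSum x b e1 => \sum_(0 <= i < range_size n b) ev (update v x i) m e1
  end.

Fixpoint den (v : nat -> nat) (c : cmd) (m : memory) : memory :=
  match c with
  | KSkip => m
  | KSet a x y z w e => store m a (v x) (v y) (v z) (v w) (ev v m e)
  | KSeq c1 c2 => den v c2 (den v c1 m)
  | KIf e c1 c2 => if ev v m e != 0 then den v c1 m else den v c2 m
  | KFor x b c1 => floop (range_size n b) (fun i => den (update v x i) c1) m
  end.

End Semantics.

(** * Compilation *)

Definition range_expr (b : range) : expr := if b is Vertices then EReg 0 else EConst 3.

(* Registers 0 and 1 hold n and n + 3; the environment [rho] maps loop variables
   to registers below [d], and registers from [d] on are scratch.  [horner r x d]
   multiplies register [d] by register [r] and adds register [x]. *)
Definition horner (r x d : nat) : program :=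
  Seq (SetReg d.+1 (EReg r))
  (Seq (SetReg d.+2 (EReg x))
  (Seq (count_down d.+1 (SetReg d.+2 (EAdd (EReg d.+2) (EReg d))))
       (SetReg d (EReg d.+2)))).

Definition horner_cost (M : nat) : nat := 4 + (M * 10 + 2) + 2.

(** A numeral in base M = n + 3, which exceeds every vertex and every color. The leading digit is
    [a.+1] rather than [a] so that all arrays lie beyond the input matrix. *)
Definition address (M a i j k l : nat) : nat :=
  (((a.+1 * M + i) * M + j) * M + k) * M + l.

Definition compile_address (a x y z w d : nat) : program :=
  Seq (SetReg d (EConst a.+1))
  (Seq (horner 1 x d) (Seq (horner 1 y d) (Seq (horner 1 z d) (horner 1 w d)))).

Definition address_cost (M : nat) : nat := 2 + 4 * horner_cost M.

Fixpoint compile_exp (e : exp) (d : nat) (rho : nat -> nat) : program :=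
  match e with
  | XC c => SetReg d (EConst c)
  | XV x => SetReg d (EReg (rho x))
  | XAdj x y => Seq (SetReg d (EReg (rho x)))
                (Seq (horner 0 (rho y) d) (SetReg d (EMem (EReg d))))
  | XGet a x y z w => Seq (compile_address a (rho x) (rho y) (rho z) (rho w) d)
                          (SetReg d (EMem (EReg d)))
  | XAdd e1 e2 => Seq (compile_exp e1 d rho) (Seq (compile_exp e2 d.+1 rho)
                      (SetReg d (EAdd (EReg d) (EReg d.+1))))
  | XSub e1 e2 => Seq (compile_exp e1 d rho) (Seq (compile_exp e2 d.+1 rho)
                      (SetReg d (ESub (EReg d) (EReg d.+1))))
  | XIf e1 e2 e3 => Seq (compile_exp e1 d rho)
                        (If (EReg d) (compile_exp e2 d rho) (compile_exp e3 d rho))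
  | XSum x b e1 => Seq (SetReg d (EConst 0)) (Seq (SetReg d.+1 (range_expr b))
      (count_down d.+1 (Seq (compile_exp e1 d.+2 (update rho x d.+1))
                            (SetReg d (EAdd (EReg d) (EReg d.+2))))))
  end.

Fixpoint compile (c : cmd) (d : nat) (rho : nat -> nat) : program :=
  match c with
  | KSkip => Skip
  | KSet a x y z w e => Seq (compile_exp e d rho)
      (Seq (compile_address a (rho x) (rho y) (rho z) (rho w) d.+1)
           (SetMem (EReg d.+1) (EReg d)))
  | KSeq c1 c2 => Seq (compile c1 d rho) (compile c2 d rho)
  | KIf e c1 c2 => Seq (compile_exp e d rho)
                       (If (EReg d) (compile c1 d rho) (compile c2 d rho))
  | KFor x b c1 => Seq (SetReg d (range_expr b))
                       (count_down d (compile c1 d.+1 (update rho x d)))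
  end.

Fixpoint exp_cost (M : nat) (e : exp) : nat :=
  match e with
  | XC _ | XV _ => 2
  | XAdj _ _ => 2 + (horner_cost M + 3)
  | XGet _ _ _ _ _ => address_cost M + 3
  | XAdd e1 e2 | XSub e1 e2 => exp_cost M e1 + (exp_cost M e2 + 4)
  | XIf e1 e2 e3 => exp_cost M e1 + (2 + (exp_cost M e2 + exp_cost M e3))
  | XSum _ _ e1 => 4 + (M * (exp_cost M e1 + 10) + 2)
  end.

Fixpoint cmd_cost (M : nat) (c : cmd) : nat :=
  match c with
  | KSkip => 1
  | KSet _ _ _ _ _ e => exp_cost M e + (address_cost M + 3)
  | KSeq c1 c2 => cmd_cost M c1 + cmd_cost M c2
  | KIf e c1 c2 => exp_cost M e + (2 + (cmd_cost M c1 + cmd_cost M c2))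
  | KFor _ _ c1 => 2 + (M * (cmd_cost M c1 + 6) + 2)
  end.

Lemma address_inj M a i j k l a' i' j' k' l' :
  i < M -> j < M -> k < M -> l < M -> i' < M -> j' < M -> k' < M -> l' < M ->
  address M a i j k l = address M a' i' j' k' l' ->
  [&& a' == a, i' == i, j' == j, k' == k & l' == l].
Proof.
have inj x y x' y' : y < M -> y' < M -> x * M + y = x' * M + y' -> x' = x /\ y' = y.
  move=> lt lt' E; have M0 : 0 < M by lia.
  have := congr1 (divn^~ M) E; have := congr1 (modn^~ M) E.
  by rewrite !modnMDl !modn_small // !divnMDl // !divn_small // !addn0.
move=> hi hj hk hl hi' hj' hk' hl' /inj[] // /inj[] // /inj[] // /inj[] // [->] -> -> -> ->.
by rewrite !eqxx.
Qed.

Lemma leq_address M a i j k l : 0 < M -> M * M <= address M a i j k l.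
Proof.
move=> M0; have H x y : x <= x * M + y by rewrite (leq_trans (leq_pmulr _ M0)) ?leq_addr.
rewrite /address; apply: leq_trans (leq_trans (H _ k) (H _ l)).
by rewrite (leq_trans _ (leq_addr _ _)) // leq_mul2r mulSn -addnA leq_addr orbT.
Qed.

(** * Correctness and cost of the compiler *)

Section Correctness.
Variables (n : nat) (g : nat -> nat -> nat).
Let M := n + 3.

(** The matrix clause ranges over all values below M because a loop variable is not known to be a
    vertex rather than a color. When [g] is read off the input cells, it holds initially by
    definition, even where [i * n + j] is the place of another entry. *)
Definition sim (v : nat -> nat) (m : memory) (d : nat) (rho : nat -> nat) (s : state) : Prop :=
  [/\ 1 < d /\ (regs s 0 = n /\ regs s 1 = M),
      forall x, [/\ rho x < d, regs s (rho x) = v x & v x < M],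
      forall i j, i < M -> j < M -> cells s (i * n + j) = g i j &
      forall a i j k l, i < M -> j < M -> k < M -> l < M ->
        cells s (address M a i j k l) = m a i j k l].

Definition frame (d : nat) (s s' : state) : Prop :=
  (forall r, r < d -> regs s' r = regs s r) /\ cells s' = cells s.

Lemma frame_trans d s1 s2 s3 : frame d s1 s2 -> frame d s2 s3 -> frame d s1 s3.
Proof. by move=> [H1 C1] [H2 C2]; split; [move=> r lt; rewrite H2 ?H1 | rewrite C2]. Qed.

Lemma frame_leq d d' s s' : d <= d' -> frame d' s s' -> frame d s s'.
Proof. by move=> le [H C]; split=> // r lt; apply: H; apply: leq_trans lt le. Qed.

Lemma frame_set_reg d r v s : d <= r -> frame d s (set_reg s r v).
Proof. by move=> le; split=> //= r' lt; rewrite /update ifF //; lia. Qed.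

Lemma sim_frame v m d rho s s' : sim v m d rho s -> frame d s s' -> sim v m d rho s'.
Proof.
move=> [[d1 [r0 r1]] H1 H2 H3] [F C]; split; rewrite ?C //; last first.
  by move=> x; have [h1 h2 h3] := H1 x; rewrite F.
by rewrite !F //; lia.
Qed.

Lemma sim_leq v m d d' rho s : d <= d' -> sim v m d rho s -> sim v m d' rho s.
Proof.
move=> le [[d1 r01] H1 H2 H3]; split=> //; first by split=> //; lia.
by move=> x; have [h1 h2 h3] := H1 x; split=> //; lia.
Qed.

Lemma sim_bind v m d rho s x i :
  sim v m d rho s -> i < M -> regs s d = i ->
  sim (update v x i) m d.+1 (update rho x d) s.
Proof.
move=> [[d1 [r0 r1]] H1 H2 H3] iM si; split=> //; first by split=> //; lia.
move=> y; rewrite /update; case: eqP => // _.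
by have [h1 h2 h3] := H1 y; split=> //; lia.
Qed.

(** The machine cannot multiply, so register [d] is added up as often as register [r] says; that
    register holds n or n + 3, whence at most M rounds. *)
Lemma runs_horner r x d s : r < d -> x < d ->
  regs s r <= M ->
  runs (horner r x d) s (horner_cost M) (fun s' =>
    frame d s s' /\ regs s' d = regs s d * regs s r + regs s x).
Proof.
move=> rd xd le.
have -> : horner_cost M = 2 + (2 + ((M * 10 + 2) + 2)) by rewrite /horner_cost; lia.
apply: runs_seq (_ : runs _ _ 2 (eq (set_reg s d.+1 (regs s r)))) _.
  exact: runs_set_reg.
move=> _ <-; set s1 := set_reg _ _ _.
apply: runs_seq (_ : runs _ _ 2 (eq (set_reg s1 d.+2 (regs s x)))) _.
  by apply: (runs_set_reg (e := EReg x)); rewrite /= /update ifF //; lia.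
move=> _ <-; set s2 := set_reg _ _ _.
pose I k s' := frame d s s' /\ (regs s' d = regs s d /\
   (k <= regs s r /\ regs s' d.+2 = regs s d * (regs s r - k) + regs s x)).
apply: runs_seq (_ : runs _ _ _ (I 0)) _.
  apply: (@runs_weaken _ _ (regs s r * (4 + 6) + 2) _ (I 0)) => //; last first.
    by rewrite leq_add2r leq_mul2r le orbT.
  apply: (@runs_count_down _ _ _ I); last 2 first.
  - split; first by apply: (frame_trans (s2 := s1)); apply: frame_set_reg; lia.
    by rewrite /= /update eqxx subnn muln0 !ifF; try lia.
  - by rewrite /= /update ifF ?eqxx //; lia.
  move=> k s' [F [E [lek E']]] Ek.
  apply: runs_set_reg; rewrite /= /update; split; last by rewrite ifF ?eqxx //; lia.
  split; first by apply: frame_trans F (frame_trans _ _);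
    [apply: (@frame_set_reg _ d.+1 k) | apply: frame_set_reg]; lia.
  rewrite /= /update eqxx; do !(rewrite ifF; last by lia).
  by do 2!split=> //; [lia | rewrite E' E; nia].
move=> s' [F [E [_ E']]].
apply: (runs_set_reg (e := EReg d.+2)); split.
  by apply: frame_trans F _; apply: frame_set_reg.
by rewrite /= /update eqxx E' subn0.
Qed.

Lemma runs_address v m d rho s a x y z w d0 : d <= d0 ->
  sim v m d rho s ->
  runs (compile_address a (rho x) (rho y) (rho z) (rho w) d0) s (address_cost M) (fun s' =>
    frame d0 s s' /\ regs s' d0 = address M a (v x) (v y) (v z) (v w)).
Proof.
move=> dd0 S.
have step s1 x1 : frame d0 s s1 -> runs (horner 1 (rho x1) d0) s1 (horner_cost M) (fun s' =>
   frame d0 s s' /\ regs s' d0 = regs s1 d0 * M + v x1).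
  move=> F; have [[d1 [_ r1]] H1 _ _] := S.
  have E1 : regs s1 1 = M by case: F => -> //; lia.
  have [lx Ex _] := H1 x1.
  have Ex1 : regs s1 (rho x1) = v x1 by case: F => -> //; lia.
  apply: runs_weaken (@runs_horner 1 (rho x1) d0 s1 _ _ _) _ _ => //; try lia.
  by move=> s' [F' ->]; rewrite E1 Ex1; split=> //; apply: frame_trans F F'.
have -> : address_cost M =
  2 + (horner_cost M + (horner_cost M + (horner_cost M + horner_cost M))).
  by rewrite /address_cost; lia.
apply: runs_seq (_ : runs _ _ 2 (fun s' => frame d0 s s' /\ regs s' d0 = a.+1)) _.
  apply: (runs_set_reg (e := EConst a.+1)); split; first exact: frame_set_reg.
  by rewrite /= /update eqxx.
move=> s1 [F1 E1]; apply: (runs_seq (step _ x F1)) => s2 [F2 E2].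
apply: (runs_seq (step _ y F2)) => s3 [F3 E3].
apply: (runs_seq (step _ z F3)) => s4 [F4 E4].
apply: (runs_weaken (step _ w F4)) => // s5 [F5 E5]; split=> //.
by rewrite E5 E4 E3 E2 E1.
Qed.

Lemma range_size_leq b : range_size n b <= M.
Proof. by case: b; rewrite /M /=; lia. Qed.

Lemma eval_range v m d rho s b : sim v m d rho s -> eval s (range_expr b) = range_size n b.
Proof. by case=> [[_ [r0 _]] _ _ _]; case: b. Qed.

Lemma range_time b : eval_time (range_expr b) = 1.
Proof. by case: b. Qed.

Lemma runs_range v m d rho s b r (Q : state -> Prop) : sim v m d rho s ->
  Q (set_reg s r (range_size n b)) -> runs (SetReg r (range_expr b)) s 2 Q.
Proof.
move=> S q; rewrite -(range_time b); apply: runs_set_reg.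
by rewrite (eval_range b S).
Qed.

Lemma runs_exp e : forall v m d rho s, sim v m d rho s ->
  runs (compile_exp e d rho) s (exp_cost M e) (fun s' =>
    frame d s s' /\ regs s' d = ev n g v m e).
Proof.
elim: e => [c|x|x y|a x y z w|e1 IH1 e2 IH2|e1 IH1 e2 IH2|e1 IH1 e2 IH2 e3 IH3|x b e IH]
  v m d rho s S /=.
- apply: (runs_set_reg (e := EConst c)); split; first exact: frame_set_reg.
  by rewrite /= /update eqxx.
- apply: (runs_set_reg (e := EReg (rho x))); split; first exact: frame_set_reg.
  by rewrite /= /update eqxx; case: S => _ /(_ x) [].
- have [[d1 [r0 r1]] H1 H2 _] := S; have [lx Ex vx] := H1 x; have [ly Ey vy] := H1 y.
  apply: runs_seq (_ : runs _ _ 2 (fun s' => frame d s s' /\ regs s' d = v x)) _.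
    apply: (runs_set_reg (e := EReg (rho x))); split; first exact: frame_set_reg.
    by rewrite /= /update eqxx.
  move=> s1 [F1 E1].
  apply: runs_seq (_ : runs _ _ _ (fun s' => frame d s s' /\ regs s' d = v x * n + v y)) _.
    have E0 : regs s1 0 = n by case: F1 => -> //; lia.
    have Ey1 : regs s1 (rho y) = v y by case: F1 => ->.
    apply: runs_weaken (@runs_horner 0 (rho y) d s1 _ _ _) _ _ => //.
    - exact: ltn_trans d1.
    - by rewrite E0 /M; lia.
    by move=> s' [F' ->]; rewrite E0 Ey1 E1; split=> //; apply: frame_trans F1 F'.
  move=> s2 [F2 E2]; apply: (runs_set_reg (e := EMem (EReg d))); split.
    by apply: frame_trans F2 _; apply: frame_set_reg.
  rewrite /= /update eqxx E2; case: F2 => _ ->; exact: H2.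
- have [_ H1 _ H3] := S; have [_ _ vx] := H1 x; have [_ _ vy] := H1 y.
  have [_ _ vz] := H1 z; have [_ _ vw] := H1 w.
  apply: (runs_seq (runs_address a x y z w (leqnn d) S)) => s2 [F2 E2].
  apply: (runs_set_reg (e := EMem (EReg d))); split.
    by apply: frame_trans F2 _; apply: frame_set_reg.
  rewrite /= /update eqxx E2; case: F2 => _ ->; exact: H3.
- apply: (runs_seq (IH1 _ _ _ _ _ S)) => s1 [F1 E1].
  have S1 := sim_leq (leqnSn d) (sim_frame S F1).
  apply: (runs_seq (IH2 _ _ _ _ _ S1)) => s2 [F2 E2].
  apply: (runs_set_reg (e := EAdd (EReg d) (EReg d.+1))); split.
    by apply: frame_trans F1 (frame_trans (frame_leq _ F2) _) => //; apply: frame_set_reg.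
  by rewrite /= /update eqxx E2; case: F2 => -> //; rewrite E1.
- apply: (runs_seq (IH1 _ _ _ _ _ S)) => s1 [F1 E1].
  have S1 := sim_leq (leqnSn d) (sim_frame S F1).
  apply: (runs_seq (IH2 _ _ _ _ _ S1)) => s2 [F2 E2].
  apply: (runs_set_reg (e := ESub (EReg d) (EReg d.+1))); split.
    by apply: frame_trans F1 (frame_trans (frame_leq _ F2) _) => //; apply: frame_set_reg.
  by rewrite /= /update eqxx E2; case: F2 => -> //; rewrite E1.
- apply: (runs_seq (IH1 _ _ _ _ _ S)) => s1 [F1 E1].
  have S1 := sim_frame S F1.
  apply: (runs_if (e := EReg d)) => /=; rewrite E1 => H; [rewrite H | rewrite H /=].
    by apply: (runs_weaken (IH2 _ _ _ _ _ S1)) => // s2 [F2 E2];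
      split=> //; apply: frame_trans F1 F2.
  by apply: (runs_weaken (IH3 _ _ _ _ _ S1)) => // s2 [F2 E2];
      split=> //; apply: frame_trans F1 F2.
set N := range_size n b.
have -> : 4 + (M * (exp_cost M e + 10) + 2) = 2 + (2 + (M * (exp_cost M e + 4 + 6) + 2)).
  by rewrite -!addnA.
apply: runs_seq (_ : runs _ _ 2 (fun s' => frame d s s' /\ regs s' d = 0)) _.
  apply: (runs_set_reg (e := EConst 0)); split; first exact: frame_set_reg.
  by rewrite /= /update eqxx.
move=> s1 [F1 E1]; have S1 := sim_frame S F1.
apply: runs_seq (_ : runs _ _ 2 (fun s' => frame d s s' /\
                      (regs s' d = 0 /\ regs s' d.+1 = N))) _.
  apply: (runs_range S1); split.
    by apply: frame_trans F1 _; apply: frame_set_reg.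
  by rewrite /= /update eqxx ifF //; lia.
move=> s2 [F2 [E2 E2']].
pose I k s' := frame d s s' /\ (k <= N /\
  regs s' d = \sum_(k <= i < N) ev n g (update v x i) m e).
apply: (@runs_weaken _ _ (N * (exp_cost M e + 4 + 6) + 2) _ (I 0)); last 2 first.
- by rewrite leq_add2r leq_mul2r range_size_leq orbT.
- by move=> s' [F [_ E]].
apply: (@runs_count_down _ _ _ I) => //; last first.
  by split=> //; rewrite big_geq.
move=> k s3 [F3 [lek E3]] E3'.
have F4 : frame d s (set_reg s3 d.+1 k) by apply: frame_trans F3 (frame_set_reg _ _ _).
have S4 : sim v m d.+1 rho (set_reg s3 d.+1 k) := sim_leq (leqnSn d) (sim_frame S F4).
have S5 : sim (update v x k) m d.+2 (update rho x d.+1) (set_reg s3 d.+1 k).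
  apply: (sim_bind _ S4); first by have := range_size_leq b; rewrite -/N; lia.
  by rewrite /= /update eqxx.
apply: (runs_seq (IH _ _ _ _ _ S5)) => s6 [F6 E6].
apply: (runs_set_reg (e := EAdd (EReg d) (EReg d.+2))); split; last first.
  rewrite /= /update ifF; last by lia.
  by case: F6 => -> // _; rewrite /= /update eqxx.
split.
  have := frame_trans F4 (frame_trans (frame_leq _ F6) (frame_set_reg _ _ _)); apply; lia.
split; first by lia.
rewrite /= /update eqxx E6 [RHS]big_ltn // addnC; congr addn.
by case: F6 => -> //; rewrite /= /update ifF ?E3 //; lia.
Qed.

Lemma runs_cmd c : forall v m d rho s, sim v m d rho s ->
  runs (compile c d rho) s (cmd_cost M c) (fun s' =>
    (forall r, r < d -> regs s' r = regs s r) /\ sim v (den n g v c m) d rho s').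
Proof.
elim: c => [|a x y z w e|c1 IH1 c2 IH2|e c1 IH1 c2 IH2|x b c IH] v m d rho s S /=.
- by exists 1, s; split=> //; constructor.
- apply: (runs_seq (runs_exp e S)) => s1 [F1 E1].
  have S1 := sim_frame S F1.
  apply: (runs_seq (runs_address a x y z w (leqnSn d) S1)) => s2 [F2 E2].
  have F12 := frame_trans F1 (frame_leq (leqnSn d) F2).
  have [[d1 [r0 r1]] H1 H2 H3] := sim_frame S F12.
  eexists; eexists; split; first exact: ExecSetMem.
    by [].
  split=> /=; first by case: F12.
  have [_ _ vx] := H1 x; have [_ _ vy] := H1 y.
  have [_ _ vz] := H1 z; have [_ _ vw] := H1 w.
  have Ed : regs s2 d = ev n g v m e by case: F2 => -> //; rewrite E1.
  split=> //=; rewrite E2 Ed /update.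
    (* The input matrix survives the write: [i * n + j] is below [M * M], and every array address is
       at least that. *)
    move=> i j iM jM; rewrite ifF ?H2 //; apply/negbTE; rewrite neq_ltn; apply/orP; left.
    apply: leq_trans (leq_address _ _ _ _ _ _); last by rewrite /M; lia.
    by move: iM jM; rewrite /M; nia.
  move=> a' i j k l iM jM kM lM; rewrite /store; case: eqP => [/address_inj/= H|ne].
    by move: H; rewrite [a == _]eq_sym [v x == _]eq_sym [v y == _]eq_sym
       [v z == _]eq_sym [v w == _]eq_sym => ->.
  rewrite ifF ?H3 //; apply/negP => /and5P[/eqP h1 /eqP h2 /eqP h3 /eqP h4 /eqP h5].
  by apply: ne; rewrite h1 h2 h3 h4 h5.
- apply: (runs_seq (IH1 _ _ _ _ _ S)) => s1 [F1 S1].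
  apply: (runs_weaken (IH2 _ _ _ _ _ S1)) => // s2 [F2 S2].
  by split=> // r lt; rewrite F2 ?F1.
- apply: (runs_seq (runs_exp e S)) => s1 [F1 E1].
  have S1 := sim_frame S F1.
  apply: (runs_if (e := EReg d)) => /=; rewrite E1 => H; [rewrite H | rewrite H /=].
    apply: (runs_weaken (IH1 _ _ _ _ _ S1)) => // s2 [F2 S2].
    by split=> // r lt; rewrite F2 //; case: F1 => ->.
  apply: (runs_weaken (IH2 _ _ _ _ _ S1)) => // s2 [F2 S2].
  by split=> // r lt; rewrite F2 //; case: F1 => ->.
set N := range_size n b.
apply: runs_seq (_ : runs _ _ 2 (fun s' => frame d s s' /\ regs s' d = N)) _.
  apply: (runs_range S); split; first exact: frame_set_reg.
  by rewrite /= /update eqxx.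
move=> s1 [F1 E1]; have S1 := sim_frame S F1.
set f := fun i => den n g (update v x i) c.
(* The invariant says that the remaining iterations lead to the final memory, which avoids any
   description of partial results. *)
pose I k s' := (forall r, r < d -> regs s' r = regs s r) /\ (k <= N /\
  exists2 m', sim v m' d rho s' & floop k f m' = floop N f m).
apply: (@runs_weaken _ _ (N * (cmd_cost M c + 6) + 2) _ (I 0)); last 2 first.
- by rewrite leq_add2r leq_mul2r range_size_leq orbT.
- by move=> s' [F [_ [m' S' /= <-]]].
apply: (@runs_count_down _ _ _ I) => //; last first.
  by split; [case: F1 | split=> //; exists m].
move=> k s3 [F3 [lek [m' S3 E3]]] E3'.
have S4 : sim v m' d rho (set_reg s3 d k) := sim_frame S3 (frame_set_reg _ _ (leqnn d)).
have S5 : sim (update v x k) m' d.+1 (update rho x d) (set_reg s3 d k).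
  apply: (sim_bind _ S4); first by have := range_size_leq b; rewrite -/N; lia.
  by rewrite /= /update eqxx.
apply: (runs_weaken (IH _ _ _ _ _ S5)) => // s6 [F6 [H0 H1 H2 H3]].
have F : forall r, r < d -> regs s6 r = regs s r.
  by move=> r lt; rewrite F6 1?ltnW //= /update ifF ?F3 //; lia.
split; last by rewrite F6 //= /update eqxx.
split=> //; split; first by lia.
exists (f k m') => //; case: S => [[d1 [r0 r1]] HS _ _].
split=> //; first by case: H0 => _ H0; split.
by move=> y; have [h1 h2 h3] := HS y; rewrite F.
Qed.

End Correctness.

(** * Polynomial bounds on costs *)

(** A pure power without a factor: for M at least 2 constants are absorbed by the exponent, and a
    power of M is what turns into a multiple of the exponent of 2 at the end. *)
Definition poly_bounded (f : nat -> nat) : Prop :=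
  exists k, forall M, 1 < M -> f M <= M ^ k.

Lemma poly_bounded_const c : poly_bounded (fun=> c).
Proof.
exists c => M M1; apply: leq_trans (ltnW (ltn_expl c (ltnSn 1))) _.
by case: c => // c; rewrite leq_exp2r.
Qed.

Lemma poly_bounded_id : poly_bounded id.
Proof. by exists 1 => M _; rewrite expn1. Qed.

Lemma poly_bounded_mul f h : poly_bounded f -> poly_bounded h ->
  poly_bounded (fun M => f M * h M).
Proof.
move=> [k H] [l H']; exists (k + l) => M M1.
by rewrite expnD leq_mul ?H ?H'.
Qed.

Lemma poly_bounded_add f h : poly_bounded f -> poly_bounded h ->
  poly_bounded (fun M => f M + h M).
Proof.
move=> [k H] [l H']; exists (k + l).+1 => M M1.
have hk : M ^ k <= M ^ (k + l) by rewrite leq_exp2l ?leq_addr.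
have hl : M ^ l <= M ^ (k + l) by rewrite leq_exp2l ?leq_addl.
rewrite expnS (leq_trans (leq_add (H M M1) (H' M M1))) //.
rewrite (leq_trans (leq_add hk hl)) // addnn -mul2n leq_mul2r M1 orbT //.
Qed.

Lemma poly_bounded_horner : poly_bounded horner_cost.
Proof.
do !apply: poly_bounded_add; try exact: poly_bounded_const.
by apply: poly_bounded_mul; [exact: poly_bounded_id | exact: poly_bounded_const].
Qed.

Lemma poly_bounded_address : poly_bounded address_cost.
Proof.
apply: poly_bounded_add; first exact: poly_bounded_const.
by apply: poly_bounded_mul; [exact: poly_bounded_const | exact: poly_bounded_horner].
Qed.

Lemma poly_bounded_exp e : poly_bounded (exp_cost^~ e).
Proof.
elim: e => [c|x|x y|a x y z w|e1 IH1 e2 IH2|e1 IH1 e2 IH2|e1 IH1 e2 IH2 e3 IH3|x b e IH] /=;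
  do ?[exact: poly_bounded_const | exact: poly_bounded_horner
      | exact: poly_bounded_address | exact: poly_bounded_id
      | apply: poly_bounded_add | assumption | apply: poly_bounded_mul].
Qed.

Lemma poly_bounded_cmd c : poly_bounded (cmd_cost^~ c).
Proof.
elim: c => [|a x y z w e|c1 IH1 c2 IH2|e c1 IH1 c2 IH2|x b c IH] /=;
  do ?[exact: poly_bounded_const | exact: poly_bounded_exp
      | exact: poly_bounded_address | exact: poly_bounded_id
      | apply: poly_bounded_add | assumption | apply: poly_bounded_mul].
Qed.

(** * The algorithm *)

Section Algorithm.

Local Notation z := 0.
Local Notation u := 1.
Local Notation w := 2.
Local Notation x := 3.
Local Notation y := 4.
Local Notation v := 5.
Local Notation a := 6.
Local Notation b := 7.
Local Notation c := 8.
Local Notation t := 9.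

(* [Forb i p j q] is nonzero once giving color p to i and color q to j is known to be
   impossible; [Forb i p i p] excludes color p at i. *)
Local Notation Dom := 0.
Local Notation Col := 1.
Local Notation Forb := 2.
Local Notation Carry := 3.
Local Notation Total := 4.
Local Notation Found := 5.

Definition XNot e := XSub (XC 1) e.
Definition XAnd e1 e2 := XIf e1 e2 (XC 0).
Definition XEq e1 e2 := XNot (XAdd (XSub e1 e2) (XSub e2 e1)).
Definition XBool e := XIf e (XC 1) (XC 0).
Definition XScalar i := XGet i z z z z.
Definition XArr i j := XGet i j z z z.
Definition KSetScalar i e := KSet i z z z z e.
Definition KSetArr i j e := KSet i j z z z e.
Definition KWhen e k := KIf e k KSkip.

Definition XCadj i j := XAdd (XAdj i j) (XEq (XV i) (XV j)).
Definition XUndominated i := XNot (XSum w Vertices (XAnd (XCadj w i) (XBool (XArr Dom w)))).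
Definition XGain i := XSum y Vertices (XAnd (XCadj i y) (XUndominated y)).

Definition greedy_step : cmd :=
  KWhen (XAnd (XGain v) (XNot (XSum x Vertices (XSub (XGain x) (XGain v)))))
        (KSetArr Dom v (XC 1)).

(** No search for the best vertex is needed: each vertex is added if it is a best choice at the
    moment of its visit, and n passes suffice because every pass dominates something new as long as
    something is undominated. *)
Definition greedy_phase : cmd := KFor t Vertices (KFor v Vertices greedy_step).

Definition XBall i j := XAdd (XCadj i j) (XSum w Vertices (XAnd (XAdj i w) (XAdj w j))).

(** The truncated difference is nonzero exactly when the ball is strictly smaller. The ball can be
    copied over [Dom] in place since [XBall] reads only the adjacency matrix. *)
Definition ball_step : cmd :=
  KWhen (XSub (XSum v Vertices (XBool (XArr Dom v))) (XSum v Vertices (XBool (XBall u v))))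
        (KFor v Vertices (KSetArr Dom v (XBall u v))).

Definition ball_phase : cmd := KFor u Vertices ball_step.

(** Computes the number of colorings of the dominating set by tripling; it becomes the counter of
    the main loop. *)
Definition total_phase : cmd :=
  KSeq (KSetScalar Total (XC 1))
  (KFor v Vertices (KWhen (XArr Dom v)
     (KSetScalar Total (XAdd (XScalar Total) (XAdd (XScalar Total) (XScalar Total)))))).

Definition for4 (k : cmd) : cmd :=
  KFor u Vertices (KFor x Colors (KFor w Vertices (KFor y Colors k))).

Definition XExcluded i j :=
  XAdd (XAnd (XArr Dom i) (XNot (XEq (XArr Col i) (XV j))))
       (XSum t Vertices (XAnd (XAdj i t) (XAnd (XArr Dom t) (XEq (XArr Col t) (XV j))))).

Definition init_phase : cmd :=
  for4 (KSet Forb u x w y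
    (XAnd (XEq (XV x) (XV y))
          (XAdd (XAdj u w) (XAnd (XEq (XV u) (XV w)) (XExcluded u x))))).

(** Both orders are looked up because the table is not kept symmetric during an update. The last
    summand makes a color already excluded at [v] count as blocked by every assignment, so that unit
    clauses are resolved by the same rule. *)
Definition XBlocked i j k :=
  XAdd (XAdd (XGet Forb i j v k) (XGet Forb v k i j)) (XGet Forb v k v k).

(* If p blocks color a of v, q blocks color b and color c is excluded, then p and q
   are incompatible. *)
Definition resolve : cmd :=
  KWhen (XIf (XAdd (XEq (XV a) (XV b)) (XAdd (XEq (XV b) (XV c)) (XEq (XV a) (XV c))))
             (XC 0) (XGet Forb v c v c))
    (for4 (KWhen (XAnd (XBlocked u x a) (XBlocked w y b)) (KSet Forb u x w y (XC 1)))).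

Definition eliminate : cmd := KFor a Colors (KFor b Colors (KFor c Colors resolve)).

Definition eliminate_phase : cmd := KFor v Vertices eliminate.

(* Vertex 0 is eliminated last. *)
Definition accept_phase : cmd :=
  KWhen (XSub (XC 3) (XSum x Colors (XBool (XGet Forb z x z x))))
        (KSetScalar Found (XC 1)).

Definition increment_step : cmd :=
  KWhen (XAnd (XScalar Carry) (XArr Dom v))
    (KIf (XSub (XC 2) (XArr Col v))
         (KSeq (KSetArr Col v (XAdd (XArr Col v) (XC 1))) (KSetScalar Carry (XC 0)))
         (KSetArr Col v (XC 0))).

Definition increment_phase : cmd :=
  KSeq (KSetScalar Carry (XC 1)) (KFor v Vertices increment_step).

Definition setup : cmd := KSeq greedy_phase (KSeq ball_phase total_phase).

Definition test : cmd := KSeq init_phase (KSeq eliminate_phase accept_phase).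

Definition iteration : cmd := KSeq test increment_phase.

(** * Loops *)

Lemma floop_ind (T : Type) (I : nat -> T -> Prop) k f m :
  (forall i m', i < k -> I i.+1 m' -> I i (f i m')) -> I k m -> I 0 (floop k f m).
Proof.
elim: k m => //= k IH m step Ik; apply: IH => [i m' ik|]; first by apply: step; lia.
exact: step.
Qed.

Lemma floop_inv (T : Type) (I : T -> Prop) k f m :
  (forall i m', i < k -> I m' -> I (f i m')) -> I m -> I (floop k f m).
Proof. exact: (@floop_ind T (fun=> I)). Qed.

(** For a fact [Q] established by one particular iteration and preserved by the later ones. As
    indices descend, the iterations after [i] are those with smaller index. *)
Lemma floop_hit (T : Type) (J Q : T -> Prop) i k f m :
  (forall j m', j < k -> J m' -> J (f j m')) ->
  (forall j m', j < k -> J m' -> Q m' -> Q (f j m')) ->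
  i < k -> (forall m', J m' -> Q (f i m')) -> J m -> Q (floop k f m).
Proof.
move=> HJ HQ ik hit Jm.
have [] : J (floop k f m) /\ (0 <= i -> Q (floop k f m)) => [|_]; last exact.
apply: (@floop_ind _ (fun j m' => J m' /\ (j <= i -> Q m'))); last by split=> //; lia.
move=> j m' jk [Jm' Qm']; split=> [|]; first exact: HJ.
rewrite leq_eqVlt => /orP[/eqP->|ji]; first exact: hit.
by apply: HQ => //; apply: Qm'.
Qed.

Fixpoint writes (k : cmd) : seq nat :=
  match k with
  | KSkip => [::]
  | KSet i _ _ _ _ _ => [:: i]
  | KSeq k1 k2 | KIf _ k1 k2 => writes k1 ++ writes k2
  | KFor _ _ k1 => writes k1
  end.

Lemma den_frame n g k : forall e m i, i \notin writes k ->
  forall i1 i2 i3 i4, den n g e k m i i1 i2 i3 i4 = m i i1 i2 i3 i4.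
Proof.
elim: k => [|i' x1 x2 x3 x4 ex|k1 IH1 k2 IH2|ex k1 IH1 k2 IH2|x1 r k IH] e m i //=.
- by rewrite inE /store => /negbTE -> .
- by rewrite mem_cat negb_or => /andP[h1 h2] *; rewrite IH2 // IH1.
- by rewrite mem_cat negb_or => /andP[h1 h2] *; case: ifP => _; rewrite ?IH1 ?IH2.
- move=> h i1 i2 i3 i4.
  apply: (@floop_inv _ (fun m' => m' i i1 i2 i3 i4 = m i i1 i2 i3 i4)) => // j m' _ <-.
  exact: IH.
Qed.

Section ForLoops.
Variables (n : nat) (g : nat -> nat -> nat) (e : nat -> nat) (k : cmd).

Definition env4 (i p j q : nat) := update (update (update (update e u i) x p) w j) y q.

Lemma for4_inv (I : memory -> Prop) m :
  (forall i p j q m', i < n -> p < 3 -> j < n -> q < 3 -> I m' ->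
     I (den n g (env4 i p j q) k m')) ->
  I m -> I (den n g e (for4 k) m).
Proof.
move=> H; do 4!(apply: floop_inv => ? ? ?); exact: H.
Qed.

Lemma for4_hit (J Q : memory -> Prop) i0 p0 j0 q0 m :
  i0 < n -> p0 < 3 -> j0 < n -> q0 < 3 ->
  (forall i p j q m', i < n -> p < 3 -> j < n -> q < 3 -> J m' ->
     J (den n g (env4 i p j q) k m')) ->
  (forall i p j q m', i < n -> p < 3 -> j < n -> q < 3 -> J m' -> Q m' ->
     Q (den n g (env4 i p j q) k m')) ->
  (forall m', J m' -> Q (den n g (env4 i0 p0 j0 q0) k m')) ->
  J m -> Q (den n g e (for4 k) m).
Proof.
move=> hi hp hj hq HJ HQ hit.
have HJQ i p j q m' : i < n -> p < 3 -> j < n -> q < 3 -> J m' /\ Q m' ->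
   J (den n g (env4 i p j q) k m') /\ Q (den n g (env4 i p j q) k m').
  by move=> ? ? ? ? [? ?]; split; [exact: HJ | exact: HQ].
have JQ3 i p j m' : i < n -> p < 3 -> j < n -> J m' /\ Q m' ->
   J (den n g (update (update (update e u i) x p) w j) (KFor y Colors k) m') /\
   Q (den n g (update (update (update e u i) x p) w j) (KFor y Colors k) m').
  by move=> ? ? ? JQ; apply: (@floop_inv _ (fun m1 => J m1 /\ Q m1)) => // *; apply: HJQ.
have JQ2 i p m' : i < n -> p < 3 -> J m' /\ Q m' ->
   J (den n g (update (update e u i) x p) (KFor w Vertices (KFor y Colors k)) m') /\
   Q (den n g (update (update e u i) x p) (KFor w Vertices (KFor y Colors k)) m').
  by move=> ? ? JQ; apply: (@floop_inv _ (fun m1 => J m1 /\ Q m1)) => // *; apply: JQ3.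
have JQ1 i m' : i < n -> J m' /\ Q m' ->
   J (den n g (update e u i) (KFor x Colors (KFor w Vertices (KFor y Colors k))) m') /\
   Q (den n g (update e u i) (KFor x Colors (KFor w Vertices (KFor y Colors k))) m').
  by move=> ? JQ; apply: (@floop_inv _ (fun m1 => J m1 /\ Q m1)) => // *; apply: JQ2.
apply: (@floop_hit _ J Q i0) => //.
- by move=> j1 m1' lt1; do 3!(apply: floop_inv => ? ? ?); apply: HJ.
- by move=> *; apply JQ1.
move=> m1; apply: (@floop_hit _ J Q p0) => //.
- by move=> j1 m1' lt1; do 2!(apply: floop_inv => ? ? ?); apply: HJ.
- by move=> *; apply JQ2.
move=> m2; apply: (@floop_hit _ J Q j0) => //.
- by move=> j1 m1' lt1; do 1!(apply: floop_inv => ? ? ?); apply: HJ.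
- by move=> *; apply JQ3.
move=> m3; apply: (@floop_hit _ J Q q0) => // *; [exact: HJ | exact: HQ].
Qed.

End ForLoops.

(** * Dominating sets *)

Section Domination.
Variables (V : finType) (G : sgraph V).
Implicit Types (D : {set V}) (p q : V).

Definition closed_nbr p : {set V} := [set q | (p == q) || G p q].

Definition undominated D : {set V} := [set q | ~~ [exists p, (p \in D) && (q \in closed_nbr p)]].

Definition gain D p : nat := #|closed_nbr p :&: undominated D|.

Definition greedy_choice D p : bool :=
  (0 < gain D p) && [forall q, gain D q <= gain D p].

(** Ties are broken arbitrarily, so that the size bound applies whatever order the vertices are
    visited in. *)
Inductive greedy : {set V} -> Prop :=
| Greedy0 : greedy set0
| GreedyU D p : greedy D -> greedy_choice D p -> greedy (p |: D).

Definition ball2 p : {set V} :=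
  [set q | (q \in closed_nbr p) || [exists r, G p r && G r q]].

Lemma undominatedU1 D p : undominated (p |: D) = undominated D :\: closed_nbr p.
Proof.
apply/setP => q; rewrite !inE negb_exists; apply/forallP/andP.
- move=> H; split; first by have := H p; rewrite !inE eqxx.
  rewrite negb_exists; apply/forallP => r; have := H r; rewrite !inE.
  by case: (r \in D); rewrite //= orbT.
- rewrite negb_exists => -[H1 /forallP H2] r; have := H2 r; rewrite !inE.
  by case: (eqVneq r p) => [->|_] /=.
Qed.

Lemma card_undominatedU1 D p : #|undominated (p |: D)| + gain D p = #|undominated D|.
Proof. by rewrite undominatedU1 /gain setIC addnC cardsID. Qed.

Lemma greedy_choice_exists D : undominated D != set0 -> exists p, greedy_choice D p.
Proof.
case/set0Pn => q qU; have [p _ pmax] := @arg_maxnP _ q xpredT (gain D) isT.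
exists p; apply/andP; split; last by apply/forallP => r; apply: pmax.
apply: leq_trans (pmax q isT); rewrite card_gt0; apply/set0Pn; exists q.
by rewrite !inE eqxx /=; move: qU; rewrite inE.
Qed.

End Domination.

(** * Meaning of the set-up phase *)

Arguments greedy_step : simpl never.
Arguments ball_step : simpl never.

Section Setup.
Variables (n : nat) (G : sgraph 'I_n) (g : nat -> nat -> nat).
Hypothesis gE : forall i j : 'I_n, g i j = G i j.
Implicit Types (e : nat -> nat) (m : memory) (i j : 'I_n).

Definition domset m : {set 'I_n} := [set i : 'I_n | m Dom i 0 0 0 != 0].

Lemma ev_not e m ex : ev n g e m (XNot ex) = (ev n g e m ex == 0).
Proof. by rewrite /=; case: (ev n g e m ex). Qed.

Lemma ev_eq e m (e1 e2 : exp) : ev n g e m (XEq e1 e2) = (ev n g e m e1 == ev n g e m e2).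
Proof. by rewrite /XEq ev_not /= addn_eq0 !subn_eq0 eqn_leq. Qed.

Lemma ev_bool e m ex : ev n g e m (XBool ex) = (ev n g e m ex != 0).
Proof. by rewrite /=; case: ifP. Qed.

Lemma if_neq0 (i1 i2 : nat) : ((if i1 != 0 then i2 else 0) != 0) = (i1 != 0) && (i2 != 0).
Proof. by case: ifP. Qed.

Lemma ev_and e m (e1 e2 : exp) :
  ev n g e m (XAnd e1 e2) = if ev n g e m e1 != 0 then ev n g e m e2 else 0.
Proof. by []. Qed.

Lemma sum_vertices_neq0 (F : nat -> nat) :
  (\sum_(0 <= i < n) F i != 0) = [exists i : 'I_n, F i != 0].
Proof. by rewrite big_mkord sum_nat_eq0 negb_forall. Qed.

Lemma sum_vertices_card (F : nat -> nat) (A : {set 'I_n}) :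
  (forall i : 'I_n, F i = (i \in A)) -> \sum_(0 <= i < n) F i = #|A|.
Proof.
move=> FE; rewrite big_mkord -sum1_card [RHS]big_mkcond /=.
by apply: eq_bigr => i _; rewrite FE; case: (i \in A).
Qed.

Lemma ev_cadj e m p q i j : e p = i -> e q = j ->
  (ev n g e m (XCadj p q) != 0) = (j \in closed_nbr G i).
Proof.
rewrite /XCadj [ev _ _ _ _ (XAdd _ _)]/= -/(ev n g e m (XEq (XV p) (XV q))) => pE qE.
rewrite -[X in _ + X]/(ev n g e m (XEq (XV p) (XV q))) ev_eq /= pE qE gE inE.
by rewrite addn_eq0 !eqb0 negb_and !negbK orbC.
Qed.

Lemma ev_undominated e m p i : e 0 = 0 -> e p = i -> p != w ->
  ev n g e m (XUndominated p) = (i \in undominated G (domset m)).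
Proof.
move=> e0 pE pw; rewrite /XUndominated ev_not inE -[_ == 0]negbK.
rewrite [ev _ _ _ _ (XSum _ _ _)]/= sum_vertices_neq0; congr (nat_of_bool (~~ _)).
apply: eq_existsb => j; set e' := update e w j.
have e'p : e' p = i by rewrite /e' /update (negbTE pw).
rewrite -[X in X != 0]/(if ev n g e' m (XCadj w p) != 0 then ev n g e' m (XBool (XArr Dom w)) else 0).
rewrite (@ev_cadj _ _ _ _ j i) //= -/(e' 0) /e' /update /= e0 inE.
by rewrite inE andbC; case: (_ || _); case: (m _ _ _ _ _).
Qed.

Lemma ev_gain e m p i : e 0 = 0 -> e p = i -> p != y -> p != w ->
  ev n g e m (XGain p) = gain G (domset m) i.
Proof.
move=> e0 pE py pw; rewrite /XGain [LHS]/=; apply: sum_vertices_card => j.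
set e' := update e y j.
have e'p : e' p = i by rewrite /e' /update (negbTE py).
rewrite -[LHS]/(ev n g e' m (XAnd (XCadj p y) (XUndominated y))) ev_and.
by rewrite (@ev_cadj _ _ _ _ i j) // (@ev_undominated _ _ _ j) // in_setI; case: (j \in closed_nbr G i).
Qed.

Lemma den_set_arr e m q p ex q' k : e 0 = 0 ->
  den n g e (KSetArr q p ex) m q' k 0 0 0 =
  if (q' == q) && (k == e p) then ev n g e m ex else m q' k 0 0 0.
Proof. by move=> e0; rewrite /= /store e0 !andbT. Qed.

Lemma den_greedy_step e m i : e 0 = 0 -> e v = i ->
  domset (den n g e greedy_step m) =
  if greedy_choice G (domset m) i then i |: domset m else domset m.
Proof.
move=> e0 vE; rewrite /greedy_step /KWhen [den _ _ _ _ _]/=.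
have -> : (ev n g e m (XAnd (XGain v) (XNot (XSum x Vertices (XSub (XGain x) (XGain v))))) != 0)
   = greedy_choice G (domset m) i.
  rewrite ev_and (@ev_gain _ _ _ i) // ev_not /greedy_choice lt0n.
  rewrite if_neq0 eqb0 negbK; congr andb.
  rewrite [ev _ _ _ _ _]/= -[LHS]negbK sum_vertices_neq0 negb_exists.
  apply: eq_forallb => j; rewrite negbK -subn_eq0.
  set e' := update e x j; rewrite -(@ev_gain e' m x j) // -(@ev_gain e' m v i) //.
case: ifP => // _; apply/setP => j; rewrite !inE /= /store /= vE e0 /=.
by rewrite andbT -[in RHS]val_eqE /=; case: ifP.
Qed.

(** While nothing is added the gains do not change, so a pass that has added nothing has compared
    every vertex with the same set; but some vertex has maximal gain, and it would have been
    taken. *)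
Lemma den_greedy_pass e m : e 0 = 0 -> greedy G (domset m) ->
  let m' := den n g e (KFor v Vertices greedy_step) m in
  greedy G (domset m') /\
  #|undominated G (domset m')| <= #|undominated G (domset m)|.-1.
Proof.
move=> e0 gr /=; set U := #|undominated G (domset m)|.
have key : 0 < U -> exists p, greedy_choice G (domset m) p.
  by rewrite /U card_gt0 => /greedy_choice_exists.
pose I k m' := greedy G (domset m') /\ (#|undominated G (domset m')| <= U.-1 \/
  domset m' = domset m /\ forall j : 'I_n, k <= j -> ~~ greedy_choice G (domset m) j).
have [||gr' [//|[E H]]] := @floop_ind _ I n (fun k => den n g (update e v k) greedy_step) m.
- move=> k m' kn [gr' H]; rewrite /I (@den_greedy_step _ _ (Ordinal kn)) //; last first.
  case: ifP => gc; [split; first exact: GreedyU|split=> //].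
    left; have eqU := card_undominatedU1 G (domset m') (Ordinal kn).
    case: H => [H|[E _]]; first by apply: leq_trans H; rewrite -eqU leq_addr.
    have /andP[gt0 _] := gc; rewrite /U -E -eqU.
    by rewrite -ltnS prednK ?(ltn_addl _ gt0) // -[X in X < _]addn0 ltn_add2l.
  case: H => [H|[E H]]; [by left | right; split=> // j].
  rewrite leq_eqVlt => /orP[/eqP kj|]; last exact: H.
  by rewrite -E (_ : j = Ordinal kn) ?gc //; apply/val_inj.
- by split=> //; right; split=> // j; have := ltn_ord j; lia.
- split=> //; rewrite E -/U; case: (posnP U) => [-> //|/key[p]].
  by rewrite (negbTE (H p _)).
Qed.

Lemma den_greedy_phase e m : e 0 = 0 -> (forall i : nat, m Dom i 0 0 0 = 0) ->
  let m' := den n g e greedy_phase m in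
  greedy G (domset m') /\ undominated G (domset m') = set0.
Proof.
move=> e0 m0; set m' := den _ _ _ _ _ => /=.
pose I k m1 := greedy G (domset m1) /\ #|undominated G (domset m1)| <= k.
have [||gr H] := @floop_ind _ I n (fun k => den n g (update e t k) (KFor v Vertices greedy_step)) m.
- move=> k m1 kn [gr H]; have [||gr' H'] := @den_greedy_pass (update e t k) m1 => //.
  by split=> //; apply: leq_trans H' _; lia.
- split; last by rewrite -[X in _ <= X]card_ord max_card.
  suff -> : domset m = set0 by constructor.
  by apply/setP => j; rewrite !inE m0.
- by split=> //; apply/eqP; rewrite -cards_eq0 -leqn0.
Qed.

Lemma ev_ball e m p q i j : e 0 = 0 -> e p = i -> e q = j -> p != w -> q != w ->
  (ev n g e m (XBall p q) != 0) = (j \in ball2 G i).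
Proof.
move=> e0 pE qE pw qw; rewrite /XBall [ev _ _ _ _ _]/= inE addn_eq0 negb_and.
rewrite -(@ev_cadj e m p q i j) //; congr orb.
rewrite sum_vertices_neq0; apply: eq_existsb => r.
by rewrite /update /= (negbTE pw) (negbTE qw) pE qE !gE; case: (G i r); case: (G r j).
Qed.

Lemma domset_ball_loop e m i : e 0 = 0 -> e u = i ->
  domset (den n g e (KFor v Vertices (KSetArr Dom v (XBall u v))) m) = ball2 G i.
Proof.
move=> e0 uE.
pose I k m' := forall j : 'I_n, k <= j -> (m' Dom j 0 0 0 != 0) = (j \in ball2 G i).
have H := @floop_ind _ I n (fun k => den n g (update e v k) (KSetArr Dom v (XBall u v))) m.
apply/setP => j; rewrite inE; apply: H => //; last by move=> j' ; have := ltn_ord j'; lia.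
move=> k m' kn IH j' kj'; rewrite den_set_arr // eqxx andTb.
rewrite (_ : update e v k v = k) //; case: (eqVneq (nat_of_ord j') k) => [E|ne].
  by rewrite (@ev_ball _ _ _ _ i j').
by apply: IH; rewrite ltn_neqAle eq_sym ne.
Qed.

Lemma den_ball_phase e m : e 0 = 0 ->
  let m' := den n g e ball_phase m in
  (domset m' = domset m \/ exists i, domset m' = ball2 G i) /\
  #|domset m'| <= #|domset m| /\ forall i, #|domset m'| <= #|ball2 G i|.
Proof.
move=> e0 /=.
pose I k m' := (domset m' = domset m \/ exists i, domset m' = ball2 G i) /\
  #|domset m'| <= #|domset m| /\ forall j : 'I_n, k <= j -> #|domset m'| <= #|ball2 G j|.
have [||H1 [H2 H3]] := @floop_ind _ I n (fun k => den n g (update e u k) ball_step) m.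
- move=> k m' kn [H1 [H2 H3]]; pose i := Ordinal kn; rewrite /I.
  set e' := update e u k; have uE : e' u = i by [].
  have -> : domset (den n g e' ball_step m') =
     if #|ball2 G i| < #|domset m'| then ball2 G i else domset m'.
    rewrite /ball_step /KWhen [den _ _ _ _ _]/=.
    rewrite -[X in X - _](_ : #|domset m'| = _); last first.
      symmetry; apply: sum_vertices_card => j; rewrite inE /= /e' /update /= e0.
      by case: (m' _ _ _ _ _).
    rewrite -[X in _ - X](_ : #|ball2 G i| = _); last first.
      symmetry; apply: sum_vertices_card => j.
      by rewrite -(@ev_ball (update e' v j) m' u v i j) // -ev_bool.
    rewrite subn_eq0 -ltnNge; case: ifP => // _.
    by rewrite (@domset_ball_loop e' m' i).
  case: ifP => lt; (split; [|split]).
  + by right; exists i.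
  + exact: leq_trans (ltnW lt) H2.
  + move=> j; rewrite leq_eqVlt => /orP[/eqP kj|/H3]; last exact: leq_trans (ltnW lt).
    by have -> : j = i by apply/val_inj.
  + by [].
  + by [].
  + move=> j; rewrite leq_eqVlt => /orP[/eqP kj|/H3 //].
    by have -> : j = i; [apply/val_inj | rewrite leqNgt lt].
- by split; [left | split=> // j; have := ltn_ord j; lia].
- by split=> //; split=> // i; apply: H3.
Qed.

(** The number of 3-colorings of the marked vertices below [k]. Peeling off the top vertex matches
    the descending loop of [total_phase], where [Total] times the weight of the unvisited part is
    constant. *)
Fixpoint weight (d : nat -> bool) (k : nat) : nat :=
  if k is k'.+1 then (if d k' then 3 * weight d k' else weight d k') else 1.

Definition domb m : nat -> bool := fun k => m Dom k 0 0 0 != 0.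

Lemma weight_card m : weight (domb m) n = 3 ^ #|domset m|.
Proof.
have -> N : weight (domb m) N = \prod_(0 <= k < N) if domb m k then 3 else 1.
  elim: N => [|N IH] /=; first by rewrite big_geq.
  by rewrite big_nat_recr //= -IH; case: ifP; rewrite ?muln1 // mulnC.
rewrite big_mkord -big_mkcond -prod_nat_const /=.
by apply: eq_bigl => i; rewrite inE.
Qed.

Lemma den_total_phase e m : e 0 = 0 ->
  let m' := den n g e total_phase m in
  (forall k, domb m' k = domb m k) /\ m' Total 0 0 0 0 = weight (domb m) n.
Proof.
move=> e0 m'; split; first by move=> k; rewrite /m' /domb den_frame.
rewrite /m' /total_phase [den _ _ _ _ _]/=.
pose I k m1 := k <= n -> (forall k', m1 Dom k' 0 0 0 = m Dom k' 0 0 0) /\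
  m1 Total 0 0 0 0 * weight (domb m) k = weight (domb m) n.
set m2 := floop _ _ _; suff [] : I 0 m2 => //; first by move=> _; rewrite muln1.
apply: (@floop_ind _ I) => //.
- move=> k m1 kn H _; have [H1 H2] := H kn; rewrite /= /update /= e0; split.
    by move=> k'; case: ifP => _; rewrite /store /= H1.
  rewrite -H2 /= /domb H1; case: ifP => // _.
  by rewrite /store /= mulnCA mulnA; congr muln; lia.
- by move=> _; rewrite /store /= e0 mul1n.
Qed.

End Setup.

(** * Meaning of the 2-list-coloring test *)

Arguments resolve : simpl never.
Arguments eliminate : simpl never.
Arguments XBlocked : simpl never.
Arguments XExcluded : simpl never.
Arguments for4 : simpl never.

Section Test.
Variables (n : nat) (G : sgraph 'I_n) (g : nat -> nat -> nat).
Hypothesis gE : forall i j : 'I_n, g i j = G i j.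
Implicit Types (e f : nat -> nat) (m : memory).

Definition proper_coloring f : Prop :=
  (forall k, f k < 3) /\ forall i j : 'I_n, G i j -> f i <> f j.

Lemma colorable_proper_coloring : colorable 3 G <-> exists f, proper_coloring f.
Proof.
split=> [[f Hf]|[f [f3 Hf]]].
  exists (fun k => if insub k is Some i then val (f i) else 0); split.
    by move=> k; case: insubP => // i _ _; apply: ltn_ord.
  move=> i j /Hf /eqP ne; rewrite !valK => E; apply: ne; exact: val_inj.
exists (fun i : 'I_n => Ordinal (f3 i)) => i j /Hf ne.
by apply/eqP => /(congr1 val).
Qed.

Definition excluded (D : {set 'I_n}) f (i : 'I_n) (p : nat) : bool :=
  (i \in D) && (f i != p) || [exists r : 'I_n, [&& G i r, r \in D & f r == p]].

Definition coloring m : nat -> nat := fun k => m Col k 0 0 0.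

Lemma ev_excluded e m (i : 'I_n) p : e 0 = 0 -> e u = i -> e x = p ->
  (ev n g e m (XExcluded u x) != 0) = excluded (domset n m) (coloring m) i p.
Proof.
move=> e0 uE xE; rewrite /XExcluded [ev _ _ _ _ _]/= addn_eq0 negb_and; congr orb.
  rewrite -[X in X != 0]/(ev n g e m (XAnd (XArr Dom u) (XNot (XEq (XArr Col u) (XV x))))).
  rewrite ev_and if_neq0 ev_not ev_eq !eqb0 negbK inE /= uE xE e0.
  by case: eqP => //; rewrite andbT.
rewrite sum_vertices_neq0; apply: eq_existsb => r; set e' := update e t r.
rewrite -[X in X != 0]/(ev n g e' m (XAnd (XAdj u t) (XAnd (XArr Dom t) (XEq (XArr Col t) (XV x))))).
rewrite !ev_and !if_neq0 ev_eq eqb0 negbK /= /e' /update /= uE xE e0 gE inE.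
by case: (G i r).
Qed.

(** Nothing is assumed about [Forb] in [m], since a test starts from the entries left by the
    previous one; all relevant entries are overwritten. *)
Lemma den_init e m (i j : 'I_n) p q : e 0 = 0 -> p < 3 -> q < 3 ->
  (den n g e init_phase m Forb i p j q != 0) =
  (p == q) && (G i j || (i == j) && excluded (domset n m) (coloring m) i p).
Proof.
move=> e0 p3 q3; set rhs := RHS.
pose J m' := domset n m' = domset n m /\ coloring m' =1 coloring m.
pose Q m' := (m' Forb i p j q != 0) = rhs.
have excl m' : J m' -> excluded (domset n m') (coloring m') i p =
                       excluded (domset n m) (coloring m) i p.
  move=> [-> E]; rewrite /excluded E; congr orb; apply: eq_existsb => r.
  by rewrite E.
have hit m' : J m' -> (ev n g (env4 e i p j q) m' (XAnd (XEq (XV x) (XV y))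
          (XAdd (XAdj u w) (XAnd (XEq (XV u) (XV w)) (XExcluded u x)))) != 0) = rhs.
  move=> Jm; rewrite ev_and if_neq0 ev_eq eqb0 negbK /rhs; congr andb.
  rewrite [ev _ _ _ _ _]/= addn_eq0 negb_and.
  rewrite -[X in _ || (X != 0)]/(ev n g (env4 e i p j q) m' (XAnd (XEq (XV u) (XV w)) (XExcluded u x))).
  rewrite ev_and if_neq0 ev_eq eqb0 negbK (@ev_excluded _ _ i p) // excl //.
  by rewrite /env4 /update /= gE eqb0 negbK.
have stepE i' p' j' q' m' : forall k h1 h2 h3 h4,
    den n g (env4 e i' p' j' q') (KSet Forb u x w y (XAnd (XEq (XV x) (XV y))
          (XAdd (XAdj u w) (XAnd (XEq (XV u) (XV w)) (XExcluded u x))))) m' k h1 h2 h3 h4 =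
    if [&& k == Forb, h1 == i', h2 == p', h3 == j' & h4 == q'] then
      ev n g (env4 e i' p' j' q') m' (XAnd (XEq (XV x) (XV y))
          (XAdd (XAdj u w) (XAnd (XEq (XV u) (XV w)) (XExcluded u x))))
    else m' k h1 h2 h3 h4 by [].
apply: (@for4_hit n g e _ J Q i p j q) => //.
- move=> i' p' j' q' m' _ _ _ _ Jm Qm; rewrite /Q stepE.
  case: ifP => [/and5P[_ /eqP <- /eqP <- /eqP <- /eqP <-]|_]; last exact: Qm.
  exact: hit.
- by move=> m' Jm; rewrite /Q stepE !eqxx; apply: hit.
Qed.

Definition forb m k p l q : bool := m Forb k p l q != 0.

Definition blocked m k p r s : bool := [|| forb m k p r s, forb m r s k p | forb m r s r s].

Definition sub_forb m m' : Prop := forall k p l q, forb m k p l q -> forb m' k p l q.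

Lemma sub_forbxx m : sub_forb m m.
Proof. by []. Qed.
Local Hint Resolve sub_forbxx : core.

Definition consistent (N : nat) m f : Prop :=
  forall k l, k < N -> l < N -> ~~ forb m k (f k) l (f l).

Definition resolve_step : cmd :=
  KWhen (XAnd (XBlocked u x a) (XBlocked w y b)) (KSet Forb u x w y (XC 1)).

Lemma forb_store m i1 i2 i3 i4 k p l q :
  forb (store m Forb i1 i2 i3 i4 1) k p l q =
  [&& k == i1, p == i2, l == i3 & q == i4] || forb m k p l q.
Proof. by rewrite /forb /store; case: ifP => [/and5P[_ -> -> -> ->]|] //= ->. Qed.

Lemma ev_blocked e m h1 h2 h3 :
  (ev n g e m (XBlocked h1 h2 h3) != 0) = blocked m (e h1) (e h2) (e v) (e h3).
Proof. by rewrite /blocked /forb /= !addn_eq0 !negb_and orbA. Qed.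

Lemma den_resolve_step e m k p l q :
  den n g (env4 e k p l q) resolve_step m =
  if blocked m k p (e v) (e a) && blocked m l q (e v) (e b)
  then store m Forb k p l q 1 else m.
Proof.
rewrite -[LHS]/(if ev n g (env4 e k p l q) m (XAnd (XBlocked u x a) (XBlocked w y b)) != 0
  then store m Forb k p l q 1 else m).
by rewrite ev_and if_neq0 !ev_blocked.
Qed.

Definition all_distinct (i1 i2 i3 : nat) : bool := [&& i1 != i2, i2 != i3 & i1 != i3].

Lemma den_resolve e m :
  den n g e resolve m =
  if all_distinct (e a) (e b) (e c) && forb m (e v) (e c) (e v) (e c)
  then den n g e (for4 resolve_step) m else m.
Proof.
rewrite /resolve -[LHS]/(if (if ev n g e m (XEq (XV a) (XV b)) +
   (ev n g e m (XEq (XV b) (XV c)) + ev n g e m (XEq (XV a) (XV c))) != 0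
   then 0 else m Forb (e v) (e c) (e v) (e c)) != 0
   then den n g e (for4 resolve_step) m else m).
move: (den n g e (for4 resolve_step) m) => m'; rewrite !ev_eq /= /all_distinct /forb.
by case: (e a == e b); case: (e b == e c); case: (e a == e c).
Qed.

Lemma eliminate_inv (I : memory -> Prop) e m :
  (forall h1 h2 h3 m', h1 < 3 -> h2 < 3 -> h3 < 3 -> I m' ->
     I (den n g (update (update (update e a h1) b h2) c h3) resolve m')) ->
  I m -> I (den n g e eliminate m).
Proof. by move=> H; do 3!(apply: floop_inv => ? ? ?); apply: H. Qed.

Lemma resolve_mono e m : sub_forb m (den n g e resolve m).
Proof.
rewrite den_resolve; case: ifP => // _.
apply: (@for4_inv n g e _ (sub_forb m)) => // k p l q m' _ _ _ _ sub.
rewrite den_resolve_step; case: ifP => // _ ? ? ? ? /sub.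
by rewrite forb_store => ->; rewrite orbT.
Qed.

Lemma eliminate_mono e m : sub_forb m (den n g e eliminate m).
Proof.
apply: (@eliminate_inv (sub_forb m)) => // h1 h2 h3 m' _ _ _ sub ? ? ? ? /sub.
exact: resolve_mono.
Qed.

Lemma blocked_sub m m' k p r s : sub_forb m m' -> blocked m k p r s -> blocked m' k p r s.
Proof. by move=> sub /or3P[] /sub; rewrite /blocked => ->; rewrite ?orbT. Qed.

Lemma blocked_consistent m f k r s : consistent n m f -> k < n -> r < n ->
  blocked m k (f k) r s -> f r != s.
Proof.
move=> con kn rn bl; apply/eqP => E; move: bl; rewrite /blocked -E.
by rewrite !(negbTE (con _ _ _ _)).
Qed.

(** A resolvent never hits a consistent coloring: if its two assignments were those of [f], they and
    the excluded color would rule out all three colors for [f] at the eliminated vertex. *)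
Lemma eliminate_sound e m f : (forall k, f k < 3) -> e v < n ->
  consistent n m f -> consistent n (den n g e eliminate m) f.
Proof.
move=> f3 vn; apply: (@eliminate_inv (fun m' => consistent n m' f)) => h1 h2 h3 m1 lt1 lt2 lt3 con1.
rewrite den_resolve; case: ifP => [/andP[dist fc]|_]; last exact: con1.
rewrite /update /= in dist fc.
have ne3 : f (e v) != h3.
  by apply/eqP => E; move: fc; rewrite -E (negbTE (con1 _ _ _ _)).
apply: (@for4_inv n g _ resolve_step (fun m' => consistent n m' f)) => // k p l q m' kn _ ln _ con.
rewrite den_resolve_step; case: ifP => [/andP[bl1 bl2]|_]; last exact: con.
rewrite /update /= in bl1 bl2.
move=> k' l' kn' ln'; rewrite forb_store negb_or con // andbT.
apply/negP => /and4P[/eqP E1 /eqP E2 /eqP E3 /eqP E4].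
rewrite -E1 -E2 in bl1; rewrite -E3 -E4 in bl2.
have ne1 := blocked_consistent con kn' vn bl1.
have ne2 := blocked_consistent con ln' vn bl2.
by move: dist (f3 (e v)) ne1 ne2 ne3; rewrite /all_distinct; lia.
Qed.

(** The table is modified while it is scanned, but it only grows: the premises, true in [m], are
    still true when the iteration with these indices is reached, and the entry written there lasts
    to the end. *)
Lemma eliminate_closed e m h1 h2 h3 k p l q :
  h1 < 3 -> h2 < 3 -> h3 < 3 -> all_distinct h1 h2 h3 -> forb m (e v) h3 (e v) h3 ->
  k < n -> p < 3 -> l < n -> q < 3 ->
  blocked m k p (e v) h1 -> blocked m l q (e v) h2 ->
  forb (den n g e eliminate m) k p l q.
Proof.
move=> lt1 lt2 lt3 dist fc kn p3 ln q3 bl1 bl2.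
have trans m1 m2 m3 : sub_forb m1 m2 -> sub_forb m2 m3 -> sub_forb m1 m3.
  by move=> s1 s2 ? ? ? ? /s1 /s2.
pose J := sub_forb m; pose Q m' := forb m' k p l q.
have mono3 e1 m' : sub_forb m' (floop 3 (fun i => den n g (update e1 c i) resolve) m').
  by apply: (@floop_inv _ (sub_forb m')) => // ? ? _ s; exact: (trans _ _ _ s (@resolve_mono _ _)).
have mono2 e1 m' : sub_forb m' (floop 3 (fun i => den n g (update e1 b i) (KFor c Colors resolve)) m').
  by apply: (@floop_inv _ (sub_forb m')) => // ? ? _ s; exact: (trans _ _ _ s (mono3 _ _)).
apply: (@floop_hit _ J Q h1) => //.
- by move=> ? ? _ s; exact: (trans _ _ _ s (mono2 _ _)).
- by move=> ? ? _ _; apply: mono2.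
move=> m1; apply: (@floop_hit _ J Q h2) => //.
- by move=> ? ? _ s; exact: (trans _ _ _ s (mono3 _ _)).
- by move=> ? ? _ _; apply: mono3.
move=> m2; apply: (@floop_hit _ J Q h3) => //.
- by move=> ? ? _ s; exact: (trans _ _ _ s (@resolve_mono _ _)).
- by move=> ? ? _ _; apply: resolve_mono.
move=> m3 s3; change (forb (den n g (update (update (update e a h1) b h2) c h3) resolve m3) k p l q).
rewrite den_resolve ifT; last by rewrite /update /= dist s3.
set e3 := update _ _ _.
have step_mono i p' j q' m' : sub_forb m' (den n g (env4 e3 i p' j q') resolve_step m').
  by rewrite den_resolve_step; case: ifP => // _ ? ? ? ?; rewrite forb_store => ->; rewrite orbT.
apply: (@for4_hit n g e3 resolve_step J Q k p l q) => //.
- by move=> ? ? ? ? ? _ _ _ _ s; exact: (trans _ _ _ s (step_mono _ _ _ _ _)).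
- by move=> ? ? ? ? ? _ _ _ _ _; apply: step_mono.
move=> m' s'; rewrite den_resolve_step ifT; last first.
  by rewrite /e3 /update /=; apply/andP; split; apply: blocked_sub s' _.
by rewrite /Q forb_store !eqxx.
Qed.

(* The coloring is extended from the vertices below k to k.  If the two colors
   of k that are not excluded are both blocked by colored vertices, then
   eliminating k has forbidden the colors of these vertices together; if one of
   them is unconditionally excluded, the other blocker is forbidden outright, and
   if both are, everything is forbidden. *)
Lemma eliminate_complete e k m : k <= n ->
  (forall r, r < k -> exists2 s, s < 3 & forb m r s r s) ->
  (exists i p j q, [/\ i < n, p < 3, j < n & q < 3] /\
     ~~ forb (floop k (fun r => den n g (update e v r) eliminate) m) i p j q) ->
  exists2 f, (forall r, f r < 3) & consistent k m f.
Proof.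
elim: k m => [|k IH] m kn lists nfull; first by exists (fun=> 0).
have mono : forall k' m', sub_forb m' (floop k' (fun r => den n g (update e v r) eliminate) m').
  by move=> k' m'; apply: (@floop_inv _ (sub_forb m')) => // i m1 _ s ? ? ? ? /s; apply: eliminate_mono.
set m1 := den n g (update e v k) eliminate m.
have sub1 : sub_forb m m1 := @eliminate_mono _ _.
(* The loop eliminates the top vertex [k] before the others, so [f] respects the table [m1], which
   already contains the resolvents at [k]. *)
have [||f f3 con] := IH m1 (ltnW kn).
- by move=> r rk; have [|s s3 /sub1] := lists r; [exact: ltnW | exists s].
- exact: nfull.
have [s3 lt3 F3] := lists k (ltnSn k).
have [s1 [s2 [lt1 lt2 dist]]] : exists s1 s2, [/\ s1 < 3, s2 < 3 & all_distinct s1 s2 s3].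
  by case: s3 lt3 {F3} => [|[|[|//]]] _; [exists 1, 2 | exists 0, 2 | exists 0, 1].
pose bad s := forb m k s k s || [exists i : 'I_k, forb m i (f i) k s || forb m k s i (f i)].
have badP s : bad s -> (forall i p, blocked m i p k s) \/
                       (exists2 i, i < k & blocked m i (f i) k s).
  case/orP => [H|/existsP[i /orP[H|H]]]; [left | right | right].
  - by move=> i p; rewrite /blocked H !orbT.
  - by exists i => //; rewrite /blocked H.
  - by exists i => //; rewrite /blocked H orbT.
have clos i p j q : i < n -> p < 3 -> j < n -> q < 3 ->
    blocked m i p k s1 -> blocked m j q k s2 -> forb m1 i p j q.
  by apply: (@eliminate_closed (update e v k) m s1 s2 s3).
have extend s : s < 3 -> ~~ bad s -> exists2 f, (forall r, f r < 3) & consistent k.+1 m f.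
  move=> lts; rewrite negb_or negb_exists => /andP[good0 /forallP good].
  have {}good i : i < k -> ~~ forb m i (f i) k s && ~~ forb m k s i (f i).
    by move=> ik; have := good (Ordinal ik); rewrite negb_or.
  have ltn i : i < k.+1 -> i != k -> i < k by rewrite ltnS ltn_neqAle => -> ->.
  exists (update f k s); first by move=> r; rewrite /update; case: ifP.
  move=> i j ik jk; rewrite /update.
  case: (eqVneq i k) => [->|ni]; case: (eqVneq j k) => [->|nj] //.
  - by have /andP[] := good j (ltn j jk nj).
  - by have /andP[] := good i (ltn i ik ni).
  - by apply: contra (con i j (ltn i ik ni) (ltn j jk nj)); apply: sub1.
have [/badP bad1|/extend] := boolP (bad s1); last exact.
have [/badP bad2|/extend] := boolP (bad s2); last exact.
case: bad1 bad2 => [all1|[i ik bl1]] [all2|[j jk bl2]].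
- have [i [p [j [q [[ltin ltp ltjn ltq] /negP[]]]]]] := nfull.
  by apply: (mono k m1); apply: clos.
- by move: (con j j jk jk); rewrite clos //; apply: ltn_trans kn.
- by move: (con i i ik ik); rewrite clos //; apply: ltn_trans kn.
- by move: (con i j ik jk); rewrite clos //; apply: ltn_trans kn.
Qed.

Lemma eliminate_phase_sound e m f : (forall k, f k < 3) ->
  consistent n m f -> consistent n (den n g e eliminate_phase m) f.
Proof.
move=> f3; apply: (@floop_inv _ (fun m' => consistent n m' f)) => k m' kn.
exact: eliminate_sound.
Qed.

Definition found m : bool := m Found 0 0 0 0 != 0.

Lemma den_accept e m : e 0 = 0 ->
  found (den n g e accept_phase m) =
  found m || [exists p : 'I_3, ~~ forb m 0 p 0 p].
Proof.
move=> e0.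
have -> : [exists p : 'I_3, ~~ forb m 0 p 0 p] =
   (ev n g e m (XSub (XC 3) (XSum x Colors (XBool (XGet Forb z x z x)))) != 0).
  rewrite /= subn_eq0 -ltnNge big_mkord.
  have E (p : 'I_3) : (if m Forb (update e x p z) (update e x p x) (update e x p z) (update e x p x) != 0
     then 1 else 0) = forb m 0 p 0 p.
    by rewrite /update /= e0 /forb; case: ifP.
  rewrite (eq_bigr _ (fun p _ => E p)) !big_ord_recl big_ord0 /=.
  apply/existsP/idP => [[p]|].
    case: p => -[|[|[|//]]] i /= /negbTE H; rewrite ?H; by do 2![case: forb].
  case H0 : (forb m 0 0 0 0); last by move=> _; exists ord0; rewrite /= H0.
  case H1 : (forb m 0 1 0 1); last by move=> _; exists (lift ord0 ord0); rewrite /= H1.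
  case H2 : (forb m 0 2 0 2); last by move=> _; exists (lift ord0 (lift ord0 ord0)); rewrite /= H2.
  by [].
rewrite /accept_phase /KWhen -[den _ _ _ _ _]/(if _ then _ else _).
case: ifP => _; last by rewrite orbF.
by rewrite /found /= /store e0 orbT.
Qed.

Lemma den_test e m : den n g e test m =
  den n g e accept_phase (den n g e eliminate_phase (den n g e init_phase m)).
Proof. by []. Qed.

(** Such an [f] respects the initial table, hence also the eliminated one, so its color at vertex 0
    is not excluded. *)
Lemma test_accepts e m f : e 0 = 0 -> 0 < n -> proper_coloring f ->
  (forall i : 'I_n, i \in domset n m -> f i = coloring m i) ->
  found (den n g e test m).
Proof.
move=> e0 n0 [f3 Hf] agree; rewrite den_test den_accept //; apply/orP; right; apply/existsP; exists (Ordinal (f3 0)).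
set m1 := den n g e init_phase m.
suff /(eliminate_phase_sound e f3) con : consistent n m1 f by apply: con.
move=> k l kn ln; rewrite /forb (@den_init e m (Ordinal kn) (Ordinal ln)) //.
apply/negP => /andP[/eqP E /orP[/Hf|/andP[_ /orP[/andP[H]|/existsP[r /and3P[H1 H2 H3]]]]]] //.
- by rewrite (agree _ H) eqxx.
- by case: (Hf _ _ H1); rewrite (agree _ H2) (eqP H3).
Qed.

(** Domination gives every vertex an excluded color, as completeness of the elimination requires: a
    vertex of the dominating set loses the colors other than its own, any other vertex loses the
    color of a dominating neighbor. *)
Lemma test_sound e m : e 0 = 0 -> 0 < n -> undominated G (domset n m) = set0 ->
  (forall i : 'I_n, i \in domset n m -> coloring m i < 3) ->
  found (den n g e test m) -> found m \/ exists f, proper_coloring f.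
Proof.
move=> e0 n0 dom col3; rewrite den_test den_accept // => /orP[H|/existsP[s H]].
  by left; move: H; rewrite /found (@den_frame _ _ eliminate_phase) // (@den_frame _ _ init_phase).
right; set m1 := den n g e init_phase m in H.
have [||f f3 con] := @eliminate_complete e n m1 (leqnn n).
- move=> r rn; have := in_set0 (Ordinal rn); rewrite -dom inE => /negbFE/existsP[i /andP[iD]].
  rewrite inE.
  have [rD _|rD /orP[/eqP E|adj]] := boolP (Ordinal rn \in domset n m).
  (* Read as a number, [coloring m r == 0] is a color different from that of [r]. *)
  + have c3 : (coloring m r == 0) < 3 by case: (_ == _).
    exists (coloring m r == 0 : nat) => //.
    rewrite /forb (@den_init e m (Ordinal rn) (Ordinal rn)) ?eqxx //.
    by rewrite /excluded rD /=; case: (coloring m r) => [|k] /=; rewrite ?orbT.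
  + by move: rD; rewrite -E iD.
  + exists (coloring m i); first exact: col3.
    rewrite /forb (@den_init e m (Ordinal rn) (Ordinal rn)) ?eqxx ?col3 //.
    rewrite /excluded; apply/orP; right; apply/orP; right; apply/existsP; exists i.
    by rewrite iD eqxx adj_sym adj.
- by exists 0, s, 0, s.
exists f; split=> // i j Gij E.
have := con i j (ltn_ord i) (ltn_ord j); rewrite /forb /m1 den_init //.
by rewrite E eqxx Gij.
Qed.

End Test.

(** * Enumeration of the colorings of the dominating set *)

(** The ternary numeral whose digits are the colors of the marked vertices. The highest vertex is
    the least significant digit because the increment loop visits it before the others. *)
Fixpoint value (d : nat -> bool) (f : nat -> nat) (k : nat) : nat :=
  if k is k'.+1 then (if d k' then 3 * value d f k' + f k' else value d f k') else 0.

Section Value.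
Variable d : nat -> bool.

Definition digits (f : nat -> nat) : Prop := forall k, d k -> f k < 3.

Lemma value_lt f k : digits f -> value d f k < weight d k.
Proof.
move=> f3; elim: k => //= k IH; case: ifP => // dk.
by have := f3 k dk; lia.
Qed.

Lemma value_inj f f' k : digits f -> digits f' -> value d f k = value d f' k ->
  forall j, j < k -> d j -> f j = f' j.
Proof.
move=> f3 f3'; elim: k => //= k IH E j; rewrite ltnS leq_eqVlt => /orP[/eqP ->|jk] dj.
  by move: E; rewrite dj; have := f3 k; have := f3' k; lia.
apply: IH => //; move: E; case: ifP => // dk.
by have := f3 k dk; have := f3' k dk; lia.
Qed.

Lemma eq_value f f' k : (forall j, j < k -> f j = f' j) -> value d f k = value d f' k.
Proof.
elim: k => //= k IH E; rewrite IH; last by move=> j jk; rewrite E // ltnW.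
by rewrite E.
Qed.

End Value.

Arguments increment_step : simpl never.

Section Increment.
Variables (n : nat) (g : nat -> nat -> nat) (d : nat -> bool).
Implicit Types (e : nat -> nat) (m : memory).

Definition carry m : nat := m Carry 0 0 0 0.

Lemma den_increment_step e m : e 0 = 0 -> den n g e increment_step m =
  if (carry m != 0) && domb m (e v) then
    if coloring m (e v) < 2 then
      store (store m Col (e v) 0 0 0 (coloring m (e v) + 1)) Carry 0 0 0 0 0
    else store m Col (e v) 0 0 0 0
  else m.
Proof.
move=> e0; rewrite -subn_gt0 lt0n -if_neq0 /carry /domb /coloring.
by rewrite /increment_step /= e0; case: (m Carry 0 0 0 0 != 0).
Qed.

(** Addition of the carry to a ternary numeral of which [k] positions remain: a carry that leaves at
    the top is worth [weight d k]. *)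
Lemma increment_loop e k m : e 0 = 0 ->
  (forall j, domb m j = d j) -> digits d (coloring m) -> carry m <= 1 ->
  let m' := floop k (fun i => den n g (update e v i) increment_step) m in
  [/\ forall j, domb m' j = d j, digits d (coloring m'),
      forall j, k <= j -> coloring m' j = coloring m j &
      value d (coloring m') k + carry m' * weight d k = value d (coloring m) k + carry m].
Proof.
move=> e0; set F := fun i : nat => den n g (update e v i) increment_step.
have step i m' : F i m' = _ := @den_increment_step (update e v i) m' e0.
clearbody F.
elim: k m => [|k IH] m dE d3 c1 /=; first by rewrite muln1.
rewrite step // (_ : update e v k v = k) // dE.
have [dk|ndk] := boolP (d k); last first.
  rewrite andbF; have [H1 H2 H3 H4] := IH m dE d3 c1; split=> // j jk.
  by rewrite H3 // ltnW.
rewrite andbT; have [c0|nc0] := eqVneq (carry m) 0.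
  rewrite /=; have [H1 H2 H3 H4] := IH m dE d3 c1; split=> //.
    by move=> j jk; rewrite H3 // ltnW.
  by move: H4; rewrite H3 //; nia.
rewrite /=; have {}c1 : carry m = 1 by lia.
case: ltnP => lt2.
  set m1 := store _ _ _ _ _ _ _.
  have col1 j : coloring m1 j = if j == k then coloring m k + 1 else coloring m j.
    by rewrite /coloring /m1 /store /= !andbT.
  have [|||H1 H2 H3 H4] := IH m1 => //.
    by move=> j dj; rewrite col1; case: eqP => _; [lia | apply: d3].
  have V : value d (coloring m1) k = value d (coloring m) k.
    by apply: eq_value => j jk; rewrite col1 ifF //; lia.
  split=> // [j jk|]; first by rewrite H3 ?col1 ?ifF //; lia.
  move: H4; rewrite V (_ : carry m1 = 0) // H3 // col1 eqxx; lia.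
set m1 := store _ _ _ _ _ _ _.
have col1 j : coloring m1 j = if j == k then 0 else coloring m j.
  by rewrite /coloring /m1 /store /= !andbT.
have [|||H1 H2 H3 H4] := IH m1 => //; first by move=> j dj; rewrite col1; case: eqP => _ //; apply: d3.
  by rewrite (_ : carry m1 = carry m) // c1.
have V : value d (coloring m1) k = value d (coloring m) k.
  by apply: eq_value => j jk; rewrite col1 ifF //; lia.
split=> // [j jk|]; first by rewrite H3 ?col1 ?ifF //; lia.
move: H4; rewrite V (_ : carry m1 = carry m) // H3 // col1 eqxx c1; have := d3 k dk; lia.
Qed.

Lemma den_increment e m : e 0 = 0 ->
  (forall j, domb m j = d j) -> digits d (coloring m) ->
  let m' := den n g e increment_phase m in
  digits d (coloring m') /\
  ((value d (coloring m) n).+1 < weight d n ->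
   value d (coloring m') n = (value d (coloring m) n).+1).
Proof.
move=> e0 dE d3; pose m1 := store m Carry 0 0 0 0 1.
rewrite (_ : den n g e increment_phase m =
  floop n (fun i => den n g (update e v i) increment_step) m1); last by rewrite /= e0.
have [||||H1 H2 H3 H4] := @increment_loop e n m1 => //.
split=> // lt; move: H4; rewrite (_ : carry m1 = 1) // (_ : coloring m1 = coloring m) //.
by move: (carry _) => [|k]; nia.
Qed.

End Increment.

Section Enumeration.
Variables (n : nat) (G : sgraph 'I_n) (g : nat -> nat -> nat) (d : nat -> bool).
Hypotheses (gE : forall i j : 'I_n, g i j = G i j) (n0 : 0 < n).
Hypothesis dom : undominated G [set i : 'I_n | d i] = set0.
Implicit Types (e : nat -> nat) (m : memory).

(** The invariant after [k] tests. The clause on the stored numeral is conditional because the last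
    increment overflows. Completeness concerns colorings of the whole graph, ordered by the value of
    their restriction to the dominating set. *)
Definition enumerated (k : nat) m : Prop :=
  [/\ forall j, domb m j = d j, digits d (coloring m),
      k < weight d n -> value d (coloring m) n = k,
      found m -> exists f, proper_coloring G f &
      forall f, proper_coloring G f -> value d f n < k -> found m].

Lemma enumerated_step e k m : e 0 = 0 -> k < weight d n ->
  enumerated k m -> enumerated k.+1 (den n g e iteration m).
Proof.
move=> e0 kT [dE d3 Vk snd cpl].
rewrite (_ : den n g e iteration m = den n g e increment_phase (den n g e test m)) //.
set m1 := den n g e test m; have {}Vk := Vk kT.
have domE : domset n m = [set i : 'I_n | d i] by apply/setP => i; rewrite !inE -dE.
have colE : coloring m1 =1 coloring m by move=> j; apply: (@den_frame n g test e m Col).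
have dE1 j : domb m1 j = d j by rewrite -dE /domb /m1 (@den_frame n g test e m Dom).
have d31 : digits d (coloring m1) by move=> j /d3; rewrite colE.
have V1 : value d (coloring m1) n = k by rewrite -Vk; apply: eq_value => j _; apply: colE.
have [d32 V2] := @den_increment n g d e m1 e0 dE1 d31.
have fE : found (den n g e increment_phase m1) = found m1.
  by rewrite /found (@den_frame n g increment_phase e m1 Found).
split=> //.
- by move=> j; rewrite -dE1 /domb (@den_frame n g increment_phase e m1 Dom).
- by rewrite -V1 => /V2.
- rewrite fE => H; have sound := @test_sound n G g gE e m e0 n0; rewrite domE in sound.
  case: (sound dom _ H) => // i; rewrite inE; exact: d3.
(* If the value of [f] is [k], injectivity makes [f] agree with the coloring just tested; if it is
   smaller, [Found] was set earlier and is never reset. *)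
move=> f pf; rewrite fE ltnS leq_eqVlt => /orP[/eqP Vf|/(cpl f pf) fm].
  apply: (@test_accepts n G g gE e m f) => // i; rewrite domE inE => di.
  apply: (@value_inj d f (coloring m) n) => //; last by rewrite Vk.
  by move=> j _; case: pf.
rewrite /m1 den_test /found.
have := @den_accept n g e (den n g e eliminate_phase (den n g e init_phase m)) e0.
rewrite /found => ->; rewrite (@den_frame _ _ eliminate_phase) // (@den_frame _ _ init_phase) //.
by move: fm; rewrite /found => ->.
Qed.

Lemma enumerated_all m : enumerated (weight d n) m -> found m <-> colorable 3 G.
Proof.
move=> [_ _ _ snd cpl]; rewrite colorable_proper_coloring; split=> [/snd //|[f pf]].
by apply: (cpl f pf); apply: value_lt => j _; case: pf.
Qed.

End Enumeration.

(** * The program *)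

(** Unbound loop variables are all mapped to register 2, which stays 0. Register 3 holds the counter
    of the main loop, so its body is compiled with scratch registers from 4 on. *)
Definition main : program :=
  let rho := fun=> 2 in
  Seq (SetReg 1 (EAdd (EReg 0) (EConst 3)))
  (Seq (compile setup 3 rho)
  (Seq (compile_exp (XScalar Total) 3 rho)
  (Seq (count_down 3 (compile iteration 4 rho))
  (Seq (compile_exp (XScalar Found) 3 rho)
       (SetReg 0 (EReg 3)))))).

(** The factor to be multiplied by the number T of colorings. The 8 merges the 6 per round with the
    2 for the exit test: T (c + 6) + 2 is at most T (c + 8) for positive T. *)
Definition main_cost (M : nat) : nat :=
  4 + (cmd_cost M setup + (exp_cost M (XScalar Total) +
  ((cmd_cost M iteration + 8) + (exp_cost M (XScalar Found) + 2)))).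

Lemma poly_bounded_main : poly_bounded main_cost.
Proof.
do ?[exact: poly_bounded_const | exact: poly_bounded_cmd
    | exact: poly_bounded_exp | apply: poly_bounded_add].
Qed.

Section Main.
Variables (n : nat) (G : sgraph 'I_n).
Hypotheses (n0 : 0 < n) (ball_dom : forall i, undominated G (ball2 G i) = set0).

Let g (i j : nat) : nat := cells (input G) (i * n + j).

Lemma input_adj (i j : 'I_n) : g i j = G i j.
Proof.
rewrite /g /=; congr nat_of_bool; apply/existsP/idP => [[i' /existsP[j' /andP[/eqP E]]]|Gij].
  have ji := ltn_ord j; have ji' := ltn_ord j'.
  have := congr1 (divn^~ n) E; have := congr1 (modn^~ n) E.
  rewrite !modnMDl !modn_small // !divnMDl // !divn_small // !addn0.
  by move=> /val_inj -> /val_inj ->.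
by exists i; apply/existsP; exists j; rewrite eqxx.
Qed.

Lemma input_zero k : n * n <= k -> cells (input G) k = 0.
Proof.
move=> le /=; apply/eqP; rewrite eqb0; apply/existsP => -[i /existsP[j /andP[/eqP E _]]].
by have := ltn_ord i; have := ltn_ord j; nia.
Qed.

Lemma main_correct : exists D D1 : {set 'I_n},
  [/\ greedy G D1, undominated G D1 = set0, #|D| <= #|D1|, forall i, #|D| <= #|ball2 G i| &
      runs main (input G) (main_cost (n + 3) * 3 ^ #|D|)
           (fun s => accepts s <-> colorable 3 G)].
Proof.
pose e0 := (fun=> 0) : nat -> nat; pose m0 : memory := fun _ _ _ _ _ => 0.
pose m1 := den n g e0 greedy_phase m0.
pose m2 := den n g e0 ball_phase m1.
pose m3 := den n g e0 total_phase m2.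
pose d := domb m2.
have [gr1 dom1] := @den_greedy_phase n G g input_adj e0 m0 erefl (fun=> erefl).
have [cases [le1 le2]] := @den_ball_phase n G g input_adj e0 m1 erefl.
have [dE total] := @den_total_phase n g e0 m2 erefl.
rewrite -/m1 in gr1 dom1 cases le1 le2; rewrite -/m2 in cases le1 le2 dE total.
exists (domset n m2), (domset n m1); split=> //.
have dom : undominated G [set i : 'I_n | d i] = set0.
  rewrite -[finset _]/(domset n m2); case: cases => [->|[i ->]] //.
set T := 3 ^ _; have TE : T = weight d n by rewrite weight_card.
set M := n + 3; set rho : nat -> nat := fun=> 2.
have start : enumerated G d 0 m3.
  have col0 : forall j, coloring m3 j = 0.
    by move=> j; rewrite /coloring /m3 (@den_frame _ _ total_phase) //
      /m2 (@den_frame _ _ ball_phase) // /m1 (@den_frame _ _ greedy_phase).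
  split=> //.
  - by move=> j _; rewrite col0.
  - by move=> _; elim: (n) => //= k ->; rewrite col0; case: ifP.
  by rewrite /found /m3 (@den_frame _ _ total_phase) //
      /m2 (@den_frame _ _ ball_phase) // /m1 (@den_frame _ _ greedy_phase).
have T0 : 0 < T by rewrite expn_gt0.
apply: (@runs_weaken _ _ (4 + (cmd_cost M setup + (exp_cost M (XScalar Total) +
  ((T * (cmd_cost M iteration + 6) + 2) + (exp_cost M (XScalar Found) + 2))))) _
  (fun s => accepts s <-> colorable 3 G)) => //; last first.
  rewrite /main_cost -/M; move: (cmd_cost M setup) (exp_cost M _) (exp_cost M _) (cmd_cost M _).
  by clear -T0 => *; nia.
apply: runs_seq (_ : runs _ _ _ (sim n g e0 m0 3 rho)) _.
  apply: (runs_set_reg (e := EAdd (EReg 0) (EConst 3))); split=> //.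
  - by move=> k; split=> //; rewrite /e0; lia.
  - move=> a' i j k l ai aj ak al; apply: input_zero.
    apply: leq_trans (leq_address _ _ _ _ _ _); last by lia.
    by rewrite leq_mul ?leq_addr.
move=> s1 S1; apply: (runs_seq (runs_cmd setup S1)) => s2 [_ S2].
rewrite (_ : den n g e0 setup m0 = m3) // in S2.
apply: (runs_seq (runs_exp (XScalar Total) S2)) => s3 [F3 E3].
have {}E3 : regs s3 3 = T by rewrite E3 TE -total.
have S3 := sim_frame S2 F3.
pose I k s := k <= T /\ exists2 m, sim n g e0 m 3 rho s & enumerated G d (T - k) m.
apply: runs_seq (_ : runs _ _ _ (I 0)) _.
  apply: (@runs_count_down _ _ _ I) => //; last first.
    by split=> //; exists m3 => //; rewrite subnn.
  move=> k s [kT [m S en]] Ek.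
  have S4 : sim n g e0 m 4 rho (set_reg s 3 k).
    by apply: (@sim_leq n g e0 m 3) => //; apply: sim_frame S (frame_set_reg _ _ _).
  apply: (runs_weaken (runs_cmd iteration S4)) => // s' [F [[H1 H2] H3 H4 H5]].
  split; last by rewrite F //= /update.
  split; first exact: ltnW.
  exists (den n g e0 iteration m).
    split=> // j; have [_ h2 h3] := H3 j; by split.
  by rewrite -subSS subSn //; apply: enumerated_step => //; [exact: input_adj | rewrite -TE; lia].
move=> s4 [_ [m S4]]; rewrite subn0 TE => en.
apply: (runs_seq (runs_exp (XScalar Found) S4)) => s5 [F5 E5].
apply: (runs_set_reg (e := EReg 3)); rewrite /accepts /= /update /= E5.
exact: enumerated_all en.
Qed.

End Main.

End Algorithm.

(** * Degrees and balls *)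

Section Degrees.
Variables (V : finType) (G : sgraph V).
Implicit Types (p q r : V).

Lemma min_degree_leq p : min_degree G <= degree G p.
Proof.
rewrite /min_degree; have := mem_index_enum p.
elim: (index_enum V) => [|q s IH] //; rewrite inE big_cons => /predU1P[->|/IH le].
  exact: geq_minl.
exact: leq_trans (geq_minr _ _) le.
Qed.

(** The minimum is not the default [#|V|], for a vertex is not its own neighbor and so has smaller
    degree; [p] is there to make the graph nonempty. *)
Lemma min_degree_attained p : exists q, degree G q = min_degree G.
Proof.
have : min_degree G = #|V| \/ exists q, degree G q = min_degree G.
  rewrite /min_degree; elim: (index_enum V) => [|q s IH].
    by left; rewrite big_nil.
  rewrite big_cons /minn; case: ifP => _ //.
  by right; exists q.
case=> // E; have := min_degree_leq p; rewrite E leqNgt => /negP[].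
rewrite /degree ltn_neqAle max_card andbT; apply/negP => /eqP EV.
have := subset_cardP EV (subset_predT _) p.
by rewrite !inE adj_irrefl.
Qed.

Lemma degree_leq_max p : degree G p <= max_degree G.
Proof. exact: leq_bigmax. Qed.

Lemma card_closed_nbr p : #|closed_nbr G p| = (degree G p).+1.
Proof.
rewrite (_ : closed_nbr G p = p |: neighbors G p).
  by rewrite cardsU1 inE adj_irrefl.
by apply/setP => q; rewrite !inE eq_sym.
Qed.

Lemma card_bigcup_leq (A : {set V}) (F : V -> {set V}) N :
  (forall p, p \in A -> #|F p| <= N) -> #|\bigcup_(p in A) F p| <= #|A| * N.
Proof.
move=> le; apply: (@leq_trans (\sum_(p in A) #|F p|)).
  elim/big_rec2: _ => [|p n B _ IH]; first by rewrite cards0.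
  by rewrite (leq_trans (leq_card_setU _ _)) ?leq_add2l.
by rewrite -sum_nat_const; apply: leq_sum.
Qed.

Lemma card_ball2 p : #|ball2 G p| <= (degree G p).+1 + degree G p * max_degree G.
Proof.
rewrite -card_closed_nbr.
have -> : ball2 G p = closed_nbr G p :|: \bigcup_(r in neighbors G p) neighbors G r.
  apply/setP => q; rewrite !inE; congr (_ || _).
  apply/existsP/bigcupP => [[r /andP[h1 h2]]|[r]]; first by exists r; rewrite inE.
  by rewrite !inE => h1 h2; exists r; rewrite h1.
rewrite (leq_trans (leq_card_setU _ _)) // leq_add2l card_bigcup_leq // => r _.
exact: degree_leq_max.
Qed.

Lemma dominating_card (D : {set V}) : undominated G D = set0 -> #|V| <= #|D| * (max_degree G).+1.
Proof.
move=> dom; rewrite -cardsT.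
have -> : [set: V] = \bigcup_(p in D) closed_nbr G p.
  apply/setP => q; rewrite inE; apply/esym/bigcupP.
  have := in_set0 q; rewrite -dom inE => /negbFE/existsP[p /andP[h1 h2]].
  by exists p.
by rewrite card_bigcup_leq // => p _; rewrite card_closed_nbr ltnS degree_leq_max.
Qed.

(** On a path with at most three edges from [p] to [q], the vertex before [q] has distance at most 2
    from [p]. *)
Lemma ball2_dominating p : is_diameter G 3 -> undominated G (ball2 G p) = set0.
Proof.
case=> dist _; apply/setP => q; rewrite !inE; apply/negbTE/negPn/existsP.
have [k [[s [ps <- <-]] _]] := dist p q.
case: s ps => [|r1 [|r2 [|r3 [|]]]] //=.
- by move=> _ _; exists p; rewrite !inE !eqxx.
- by move=> /andP[G1 _] _; exists r1; rewrite !inE G1 eqxx orbT.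
- move=> /and3P[G1 G2 _] _; exists r2; rewrite !inE eqxx /= andbT; apply/orP; right.
  by apply/existsP; exists r1; rewrite G1.
- move=> /and4P[G1 G2 G3 _] _; exists r2; rewrite !inE G3 orbT andbT; apply/orP; right.
  by apply/existsP; exists r1; rewrite G1.
Qed.

(* A vertex of degree 1 and its neighbor would form a connected component. *)
Lemma irreducible_degree p : irreducible_graph G -> is_diameter G 3 -> 1 < degree G p.
Proof.
move=> [_ _ irr] [dist [v1 [v2 [_ far]]]].
have v12 : v1 != v2 by apply/eqP => E; have := far [::] isT E.
have deg0 q : 0 < degree G q.
  rewrite card_gt0; apply/eqP => N0.
  have [r rq] : exists r, q != r.
    by case: (eqVneq q v1) => [->|]; [exists v2 | exists v1].
  by have := irr q r rq; rewrite N0 sub0set.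
rewrite ltn_neqAle deg0 andbT eq_sym; apply/negP => /cards1P[q Nq].
(* Another neighbor [r] of [q] would have the whole neighborhood of [p], namely [q] alone, inside
   its own. *)
have nq : neighbors G q = [set p].
  apply/setP => r; rewrite !inE; apply/idP/eqP => [Gqr|->]; last first.
    by rewrite adj_sym; have := set11 q; rewrite -Nq inE.
  apply/eqP; rewrite eq_sym; apply: contraT => pr.
  by have := irr p r pr; rewrite Nq sub1set inE adj_sym Gqr.
have closed r s : r \in [set p; q] -> path G r s -> last r s \in [set p; q].
  elim: s r => //= r' s IH r rpq /andP[Grr' ps]; apply: IH ps.
  move: rpq; rewrite !inE => /orP[] /eqP E; rewrite {}E in Grr'.
    have : r' \in neighbors G p by rewrite inE.
    by rewrite Nq inE => ->; rewrite orbT.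
  have : r' \in neighbors G q by rewrite inE.
  by rewrite nq inE => ->.
have all_pq r : r \in [set p; q].
  have [k [[s [ps <- _]] _] _] := dist p r.
  by apply: closed ps; rewrite !inE eqxx.
have Gpq : G p q by have := set11 q; rewrite -Nq inE.
have G12 : G v1 v2.
  have := all_pq v1; have := all_pq v2; rewrite !inE.
  move=> /orP[] /eqP E2 /orP[] /eqP E1; move: v12; rewrite E1 E2 ?eqxx //.
  by rewrite adj_sym.
by have := far [:: v2]; rewrite /= G12 => /(_ isT erefl).
Qed.

(** Double counting: summed over all vertices, the gains count each undominated vertex once per
    member of its closed neighborhood, and no summand exceeds the gain of [p]. *)
Lemma greedy_choice_gain D p : greedy_choice G D p ->
  #|undominated G D| * (min_degree G).+1 <= #|V| * gain G D p.
Proof.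
move=> /andP[_ /forallP pmax].
apply: (@leq_trans (\sum_(r : V) gain G D r)); last first.
  by rewrite -sum_nat_const; apply: leq_sum.
have gainE r : gain G D r = \sum_(y in undominated G D) (y \in closed_nbr G r : nat).
  rewrite /gain setIC -sum1_card big_mkcond [RHS]big_mkcond; apply: eq_bigr => y _.
  by rewrite in_setI; case: (y \in undominated G D); case: (y \in closed_nbr G r).
rewrite (eq_bigr _ (fun r _ => gainE r)) exchange_big /= -sum_nat_const.
apply: leq_sum => y _; rewrite (@leq_trans #|closed_nbr G y|) //.
  by rewrite card_closed_nbr ltnS min_degree_leq.
rewrite -sum1_card big_mkcond; apply: leq_sum => r _.
by rewrite !inE eq_sym adj_sym; case: (_ || _).
Qed.

End Degrees.

(** * Size of greedy dominating sets *)

Section GreedyBound.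
Local Open Scope ring_scope.
Import Order.TTheory GRing.Theory Num.Theory.
Variables (R : realType) (V : finType) (G : sgraph V).
Let q : R := (min_degree G).+1%:R / #|V|%:R.

(* For j <= #|D| the inequality is preserved because a greedy choice dominates at
   least one new vertex; for j = #|D| + 1 because, by averaging, it dominates at
   least the fraction q of the remaining ones. *)
Lemma greedy_invariant D : greedy G D -> forall j, (j <= #|D|)%N ->
  (#|undominated G D| + (#|D| - j))%:R <= #|V|%:R * (1 - q) ^+ j.
Proof.
elim=> [|{}D p gr IH choice] j.
  by rewrite cards0 leqn0 => /eqP->; rewrite subnn addn0 expr0 mulr1 ler_nat max_card.
have V0 : (0 < #|V|)%N by apply/card_gt0P; exists p.
have /andP[gain0 _] := choice.
have pD : p \notin D.
  apply/negP => pD; move: gain0; rewrite card_gt0 => /set0Pn[y].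
  by rewrite in_setI [y \in undominated _ _]inE negb_exists => /andP[h /forallP/(_ p)];
    rewrite pD h.
have cardU := card_undominatedU1 G D p.
rewrite cardsU1 pD add1n leq_eqVlt ltnS => /orP[/eqP->|le]; last first.
  by apply: le_trans (IH _ le); rewrite ler_nat subSn //; lia.
rewrite subnn addn0 exprSr mulrA.
have q1 : q <= 1.
  rewrite ler_pdivrMr ?ltr0n // mul1r ler_nat.
  apply: leq_trans (max_card (closed_nbr G p)); rewrite card_closed_nbr ltnS.
  exact: min_degree_leq.
apply: le_trans (_ : #|undominated G D|%:R * (1 - q) <= _); last first.
  by apply: ler_wpM2r; rewrite ?subr_ge0 //; have := IH _ (leqnn _); rewrite subnn addn0.
rewrite mulrBr mulr1 -cardU natrD -addrA -[X in X <= _]addr0 lerD2l subr_ge0 -natrD cardU.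
rewrite /q mulrA ler_pdivrMr ?ltr0n // -!natrM ler_nat [(gain _ _ _ * _)%N]mulnC.
exact: greedy_choice_gain.
Qed.

(** After j choices at most n (1 - q) ^ j vertices are undominated, and each further choice
    dominates one of them at least; 1 - q is at most exp (- q). The parameter j is left free, to be
    optimized later. *)
Lemma greedy_dominating_bound D j : (0 < #|V|)%N -> greedy G D -> undominated G D = set0 ->
  #|D|%:R <= j%:R + #|V|%:R * expR (- (q * j%:R)).
Proof.
move=> V0 gr dom; have [le|/ltnW lt] := leqP j #|D|; last first.
  by apply: ler_wpDr; rewrite ?ler_nat // mulr_ge0 ?expR_ge0.
have := greedy_invariant gr le; rewrite dom cards0 add0n natrB // lerBlDl => /le_trans; apply.
have q1 : q <= 1.
  have /card_gt0P[p _] := V0.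
  rewrite ler_pdivrMr ?ltr0n // mul1r ler_nat.
  apply: leq_trans (max_card (closed_nbr G p)); rewrite card_closed_nbr ltnS.
  exact: min_degree_leq.
have -> : expR (- (q * j%:R)) = expR (- q) ^+ j by rewrite -expRM_natl mulrN mulrC.
rewrite lerD2l ler_wpM2l // lerXn2r ?nnegrE ?subr_ge0 ?expR_ge0 //.
exact: expR_ge1Dx.
Qed.

End GreedyBound.

(** * The running time *)

Section Bounds.
Local Open Scope ring_scope.
Import Order.TTheory GRing.Theory Num.Theory.
Variable R : realType.

Lemma ln2_le1 : ln 2 <= 1 :> R.
Proof. by rewrite (_ : 2 = 1 + 1 :> R) //; apply: le_ln1Dx; lra. Qed.

(** The inequality ln (1 + x) <= x at x = - 1 / 2. *)
Lemma ln2_ge_half : 1 / 2 <= ln 2 :> R.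
Proof.
have := @le_ln1Dx R (- (1 / 2)).
rewrite (_ : 1 + - (1 / 2) = 2^-1 :> R); last by lra.
rewrite lnV ?posrE // lerN2; apply; lra.
Qed.

Lemma log2_ge1 (d : nat) : (1 < d)%N -> 1 <= log2 (d%:R : R).
Proof.
move=> d1; rewrite /log2 ler_pdivlMr ?mul1r; last by rewrite ln_gt0 // ltr1n.
by rewrite ler_ln ?posrE ?ltr0n ?ler_nat //; lia.
Qed.

(** [B] stands for either term of the minimum. The 8 comes from 3 <= 2 ^ 2 and D <= 4 B, and the
    polynomial factor contributes K times the exponent 5 B. *)
Lemma time_bound (K D M t : nat) (B : R) : (t <= M ^ K * 3 ^ D)%N -> 
  M%:R <= 2 `^ (5 * B) -> D%:R <= 4 * B -> t%:R <= 2 `^ ((5 * K%:R + 8) * B).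
Proof.
move=> tle Mle Dle; apply: (@le_trans _ _ ((M ^ K * 3 ^ D)%N%:R)); first by rewrite ler_nat.
rewrite (_ : (5 * K%:R + 8) * B = 5 * B * K%:R + 8 * B); last by lra.
rewrite powRD ?pnatr_eq0 ?implybT // natrM ler_pM //.
  by rewrite powRrM powR_mulrn ?powR_ge0 // natrX lerXn2r ?nnegrE ?powR_ge0.
apply: (@le_trans _ _ (2 `^ (2 * D%:R))); last first.
  by apply: ler_powR; [rewrite ler1n | lra].
rewrite powRrM (powR_mulrn 2) // powR_mulrn ?exprn_ge0 // natrX lerXn2r ?nnegrE ?exprn_ge0 //.
by rewrite -natrX ler_nat.
Qed.

(** With x = delta * Delta, a ball has at most 2 x vertices and n is at most 2 x ^ 2. The 5 is 1 + 1
    + 3, from bounding each factor x by 2 ^ x and the remaining 8 by 2 ^ (3 x). *)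
Lemma polylog_degree (n D delta Delta : nat) :
  (1 < delta)%N -> (1 < Delta)%N -> (D <= delta.+1 + delta * Delta)%N ->
  (n <= (delta.+1 + delta * Delta) * Delta.+1)%N ->
  (n + 3)%:R <= 2 `^ (5 * (delta%:R * Delta%:R)) :> R /\
  D%:R <= 4 * (delta%:R * Delta%:R) :> R.
Proof.
move=> d1 D1 Dle nle; rewrite -!natrM powR_mulrn // -natrX !ler_nat.
set x := (delta * Delta)%N in Dle nle *; have x4 : (4 <= x)%N by rewrite /x; nia.
have Dx : (delta.+1 + x <= 2 * x)%N by rewrite /x; nia.
split; last by lia.
have Dx' : (Delta.+1 <= x)%N by rewrite /x; nia.
have : (n <= 2 * x * x)%N by apply: leq_trans nle _; exact: leq_mul.
have := ltn_expl x (ltnSn 1); rewrite (_ : 5 * x = x + x + 3 * x)%N; last by lia.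
rewrite 2!expnD => lt2 lex; have : (2 ^ 3 <= 2 ^ (3 * x))%N by rewrite leq_exp2l //; lia.
move: (2 ^ x)%N (2 ^ (3 * x))%N lt2 => X Y lt2 Y8.
have xx : (x * x <= X * X)%N by apply: leq_mul; apply: ltnW.
have xx4 : (4 * 4 <= x * x)%N by apply: leq_mul.
by apply: (@leq_trans (X * X * 8)%N); [lia | apply: leq_mul].
Qed.

Lemma polylog_greedy (n D delta : nat) :
  (1 < delta)%N -> (delta < n)%N ->
  (forall j, D%:R <= j%:R + n%:R * expR (- (delta.+1%:R / n%:R * j%:R)) :> R) ->
  (n + 3)%:R <= 2 `^ (5 * (n%:R / delta%:R * log2 delta%:R)) :> R /\
  D%:R <= 4 * (n%:R / delta%:R * log2 delta%:R) :> R.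
Proof.
move=> d1 dn Dle; have dd : (delta.+1 <= delta ^ 2)%N by rewrite expnS expn1; nia.
set r : R := n%:R / delta%:R; set l : R := log2 delta%:R.
have d0 : 0 < delta%:R :> R by rewrite ltr0n; lia.
have n0 : 0 < n%:R :> R by rewrite ltr0n; lia.
have l1 : 1 <= l by exact: log2_ge1.
have r1 : 1 <= r by rewrite ler_pdivlMr // mul1r ler_nat ltnW.
have ln20 : 0 < ln 2 :> R by rewrite ln_gt0 // ltr1n.
have lnd : ln delta%:R = l * ln 2 by rewrite /l /log2 divfK // gt_eqF.
have hh := ln2_ge_half; have h1 := ln2_le1.
have rl : r <= r * l by rewrite ler_peMr //; lra.
split.
  have M0 : 0 < (n + 3)%:R :> R by rewrite ltr0n; lia.
  rewrite -ler_ln ?posrE ?powR_gt0 // ln_powR.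
  (* From n + 3 <= 4 n and n = r delta. In units of r l ln 2, the two factors 2 cost 1 each, ln r
     costs 2 because ln r <= r and 2 ln 2 >= 1, and ln delta costs 1; hence the 5. *)
  apply: (@le_trans _ _ (ln (2 * 2 * (r * delta%:R)))).
    rewrite ler_ln ?posrE //; last by rewrite /r divfK ?gt_eqF // !mulr_gt0.
    by rewrite /r divfK ?gt_eqF // -!natrM ler_nat; lia.
  have r0 : 0 < r by lra.
  have lnE (x y : R) : 0 < x -> 0 < y -> ln (2 * 2 * (x * y)) = ln 2 + ln 2 + (ln x + ln y).
    by move=> x0 y0; rewrite !lnM ?posrE ?mulr_gt0.
  rewrite lnE // lnd.
  have lnr : ln r <= r by rewrite ltW // ln_sublinear.
  have : ln r <= 2 * (r * l) * ln 2 by nra.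
  have : l * ln 2 <= r * l * ln 2 by rewrite ler_wpM2r //; [lra | nra].
  have : ln 2 <= r * l * ln 2 by rewrite ler_peMl //; lra.
  lra.
(* This choice balances the two summands: at j = L the exponential term equals n / (delta + 1),
   which is below r. Rounding up costs 1, so D is at most L + 1 + r, and 1 and r are each at most r
   l. *)
pose L : R := n%:R * ln delta.+1%:R / delta.+1%:R.
have d10 : 0 < delta.+1%:R :> R by rewrite ltr0n.
have L0 : 0 <= L by rewrite divr_ge0 ?mulr_ge0 ?ln_ge0 ?ler1n.
have /andP[trle lttr] := truncn_itv L0.
have {}Dle := Dle (Num.trunc L).+1.
have exple : n%:R * expR (- (delta.+1%:R / n%:R * (Num.trunc L).+1%:R)) <= r.
  apply: (@le_trans _ _ (n%:R * expR (- ln delta.+1%:R))).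
    rewrite ler_wpM2l // ler_expR lerN2.
    rewrite -[X in X <= _](_ : delta.+1%:R / n%:R * L = _); last first.
      by rewrite /L; field; rewrite nat1r !gt_eqF.
    by rewrite ler_wpM2l ?divr_ge0 // ltW.
  rewrite expRN lnK ?posrE // ler_wpM2l // lef_pV2 ?posrE // ler_nat.
  exact: leqnSn.
(* The factor 2 comes from delta + 1 <= delta ^ 2. *)
have Lle : L <= 2 * (r * l).
  have ln2d : ln delta.+1%:R <= 2 * ln delta%:R :> R.
    by rewrite mulr_natl -lnXn // ler_ln ?posrE ?exprn_gt0 // -natrX ler_nat.
  rewrite ler_pdivrMr //.
  apply: (@le_trans _ _ (n%:R * (2 * l))).
    rewrite ler_wpM2l // (le_trans ln2d) // ler_wpM2l // lnd.
    by rewrite ler_piMr //; lra.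
  have -> : n%:R = r * delta%:R by rewrite /r divfK ?gt_eqF.
  have : delta%:R <= delta.+1%:R :> R by rewrite ler_nat.
  have : 0 <= r * l by nra.
  nra.
have : (Num.trunc L).+1%:R <= L + 1 :> R by rewrite -natr1 lerD2r.
lra.
Qed.

End Bounds.

Import Order.TTheory GRing.Theory Num.Theory.
Local Open Scope ring_scope.

Theorem theorem4 :
  exists P : program, forall R : realType, exists C : R,
  forall (n : nat) (G : sgraph 'I_n),
    irreducible_graph G -> is_diameter G 3 ->
    let delta : R := (min_degree G)%:R in
    let Delta : R := (max_degree G)%:R in
    exists (t : nat) (s : state),
      [/\ exec P (input G) t s,
          accepts s <-> colorable 3 G &
          t%:R <= 2 `^ (C * Num.min (delta * Delta) (n%:R / delta * log2 delta))].
Proof.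
have [K costK] := poly_bounded_main.
exists main => R; exists (5 * K%:R + 8) => n G irr diam delta Delta.
have [v1 [v2 _]] := diam.2.
have n0 : (0 < n)%N := leq_ltn_trans (leq0n v1) (ltn_ord v1).
have ball_dom i := ball2_dominating i diam.
have [D [D1 [gr dom leD leball [t [s [ex tle acc]]]]]] := main_correct n0 ball_dom.
exists t, s; split=> //.
have [i degi] := min_degree_attained G v1.
have d1 : (1 < min_degree G)%N by rewrite -degi irreducible_degree.
have D1' : (1 < max_degree G)%N by apply: leq_trans d1 _; rewrite -degi degree_leq_max.
have {}tle : (t <= (n + 3) ^ K * 3 ^ #|D|)%N.
  by apply: leq_trans tle _; rewrite leq_mul2r costK ?orbT //; lia.
have balli := card_ball2 G i; rewrite degi in balli.
have [||MA DA] := @polylog_degree R n #|D| _ _ d1 D1'.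
- exact: leq_trans (leball i) balli.
- rewrite -[n in (n <= _)%N]card_ord; apply: leq_trans (dominating_card (ball_dom i)) _.
  exact: leq_mul.
have [||MB DB] := @polylog_greedy R n #|D| _ d1.
- have := max_card (closed_nbr G i).
  by rewrite card_closed_nbr degi card_ord.
- move=> j; apply: (@le_trans _ _ #|D1|%:R); first by rewrite ler_nat.
  have := @greedy_dominating_bound R _ G D1 j _ gr dom.
  by rewrite card_ord; apply.
(* Both estimates hold for the same D, so either outcome of the minimum is covered. *)
by have [_|_] := leP (delta * Delta) _; apply: time_bound tle _ _.
Qed.
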